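(* Let $\gamma\in[0,\tfrac12]$, $\lambda\in(0,1]$, $\delta\in[\gamma/2,\tfrac12]$, $r=\frac{\lambda d}{\log^2 d}$, $k=d/r$, and \[p=\binom{k}{\delta k}2^{-k},\qquad q=\binom{\gamma k}{\gamma k/2}\binom{(1-\gamma)k}{(\delta-\gamma/2)k}2^{-k}.\] Run the bucketing algorithm described in the context with these $r,\delta$ and with $N=d/q$, $P=(d+1)^{r+1}$ on a uniformly random instance of $\mathcal{CP}_{d,\lambda,\gamma}$. Then the algorithm outputs a set containing the planted pair $(\vec x,\vec y)$ with probability overwhelming in $d$ (in fact at least $1-d\,e^{-d}$ for large $d$), and its expected running time is \[ \max\Big(q^{-r},\ \frac{2^{\lambda d}p^{r-1}}{q^r},\ \frac{(2^{\lambda d}p^r)^2}{q^r}\Big)^{1+o(1)}\quad (d\to\infty). \]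
   Context: All logarithms are base 2. $\mathrm{wt}$ is Hamming weight. For $\vec v\in\mathbb F_2^d$ and $I=\{i_1<\dots<i_m\}\subseteq[d]$, $\vec v_I=(v_{i_1},\dots,v_{i_m})$. For $r\mid d$ and $i\in[r]$, the $i$-th block is $B_{i,r}=[(i-1)\frac dr+1,\ i\frac dr]$. Problem $\mathcal{CP}_{d,\lambda,\gamma}$ (uniform version): the input consists of two lists $L_1=(\vec v_i)_{i\in[2^{\lambda d}]}$, $L_2=(\vec w_i)_{i\in[2^{\lambda d}]}$ of vectors in $\mathbb F_2^d$, all entries independent and uniformly random, except for one distinguished (planted) pair $(\vec x,\vec y)\in L_1\times L_2$ with $\mathrm{wt}(\vec x+\vec y)=\gamma d$; for every $i,j$ the vectors $\vec v_i,\vec w_j$ are independent. The goal is to find $(\vec x,\vec y)$ given $L_1,L_2,\gamma$. The algorithm (parameters $r\mid d$, $k=d/r$, $P,N\in\mathbb N$, $\delta\in[0,\tfrac12]$; rounding of parameters to integers is ignored): repeat $P$ times independently: pick a uniformly random permutation $\pi$ of the $d$ coordinates and apply it to every vector of both lists. Build a tree whose root (level 0) is the pair of permuted lists $(A,B)$. For each node $(A,B)$ at level $i<r$, choose $N$ independent uniform vectors $\vec z\in\mathbb F_2^k$, and for each such $\vec z$ create a child $(A',B')$ at level $i+1$, where $A'=\{\vec v\in A:\mathrm{wt}(\vec v_{B_{i+1,r}}+\vec z)=\delta k\}$ and $B'=\{\vec w\in B:\mathrm{wt}(\vec w_{B_{i+1,r}}+\vec z)=\delta k\}$. For each leaf $(A,B)$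 at level $r$, compare all pairs in $A\times B$ and output those $(\vec v,\vec w)$ with $\mathrm{wt}(\vec v+\vec w)=\gamma d$ (undoing $\pi$). The output is the union over all repetitions. Running time counts all list scans, node creations (every tree node costs at least one step) and pairwise comparisons (each costing $\mathrm{poly}(d)$). ''Overwhelming in $d$'' means $1$ minus a function that is eventually smaller than every inverse polynomial in $d$. *)

(* Defs.v *)
From Stdlib Require Import Reals.
From mathcomp Require Import all_boot fingroup perm.

Set Implicit Arguments.
Unset Strict Implicit.
Unset Printing Implicit Defensive.

Definition bvec (n : nat) := {ffun 'I_n -> bool}.

Definition wt (n : nat) (v : bvec n) : nat := #|[set i | v i]|.

Definition bxor (n : nat) (u v : bvec n) : bvec n := [ffun i => u i (+) v i].

Definition vat (n : nat) (v : bvec n) (m : nat) : bool :=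
  oapp v false (insub m : option 'I_n).

Definition pvec (d : nat) (pi : {perm 'I_d}) (v : bvec d) : bvec d :=
  [ffun i => v (pi i)].

(* wt((pi v)_{B_{b+1,r}} + z) = w, block b (0-based) = coordinates
   b*k, ..., b*k + k - 1 (0-based), i.e. B_{b+1,r} with k = d/r. *)
Definition inbucket (d k : nat) (pi : {perm 'I_d}) (b : nat) (z : bvec k)
    (w : nat) (v : bvec d) : bool :=
  #|[set j : 'I_k | vat (pvec pi v) (b * k + j) != z j]| == w.

(* The tree.  A node at level l is identified by its path from the     *)
(* root, a prefix of length l of child indices in 'I_N, encoded as a    *)
(* function s : 'I_r -> option 'I_N with s m <> None iff m < l.         *)
Definition pref (r N : nat) := {ffun 'I_r -> option 'I_N}.

Definition is_node (r N l : nat) (s : pref r N) : bool :=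
  [forall m : 'I_r, (s m != None) == (m < l)].

(* prefix of s of length m+1 (the node at level m+1 on the path s) *)
Definition trunc (r N : nat) (m : 'I_r) (s : pref r N) : pref r N :=
  [ffun m' : 'I_r => if m' <= m then s m' else None].

(* prefix of s of length l (the parent of a level-(l+1) node s) *)
Definition parent (r N : nat) (l : nat) (s : pref r N) : pref r N :=
  [ffun m' : 'I_r => if m' < l then s m' else None].

(* Randomness of one repetition: the permutation pi, and for every node
   at level m+1 (m : 'I_r), given by its path prefix, the vector z in
   F_2^k that was drawn (by its parent) to create it.  Z is a uniformly
   random function, so the z's of distinct nodes are i.i.d. uniform
   (entries indexed by non-prefixes are never used). *)
Definition rep_rand (d r k N : nat) :=
  ({perm 'I_d} * {ffun ('I_r * pref r N) -> bvec k})%type.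

(* v belongs to the list of the node (l, s) (for l <= r):
   it passed the filters of the levels 1..l along the path s. *)
Definition in_node (d r k N w : nat) (rho : rep_rand d r k N) (l : nat)
    (s : pref r N) (v : bvec d) : bool :=
  [forall m : 'I_r, (m < l) ==> inbucket rho.1 m (rho.2 (m, trunc m s)) w v].

(* Instances of CP: uniformly random lists L1, L2 of size L with one    *)
(* planted pair at uniformly random positions (i0, j0): x = L1 i0 and    *)
(* y = x + e with e uniform among the vectors of weight W.              *)
(* (The entry L2 j0 of the raw data is overwritten and thus unused.)    *)
Definition inst (d L W : nat) :=
  ('I_L * 'I_L * {ffun 'I_L -> bvec d} * {ffun 'I_L -> bvec d}
   * {e : bvec d | wt e == W})%type.

Definition list1 (d L W : nat) (I : inst d L W) : {ffun 'I_L -> bvec d} :=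
  I.1.1.2.

Definition list2 (d L W : nat) (I : inst d L W) : {ffun 'I_L -> bvec d} :=
  [ffun j => if j == I.1.1.1.2 then bxor (I.1.1.2 I.1.1.1.1) (val I.2)
             else I.1.2 j].

Definition planted_x (d L W : nat) (I : inst d L W) : bvec d :=
  list1 I I.1.1.1.1.
Definition planted_y (d L W : nat) (I : inst d L W) : bvec d :=
  list2 I I.1.1.1.2.

Definition rep_outputs (d L W r k N w : nat) (I : inst d L W)
    (rho : rep_rand d r k N) (u v : bvec d) : bool :=
  [exists s : pref r N, is_node r s &&
    [exists i : 'I_L, [exists j : 'I_L,
       [&& list1 I i == u, list2 I j == v,
           in_node w rho r s (list1 I i), in_node w rho r s (list2 I j)
         & wt (bxor u v) == W]]]].

Definition nodeA (d L W r k N w : nat) (I : inst d L W)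
    (rho : rep_rand d r k N) (l : nat) (s : pref r N) : nat :=
  #|[set i : 'I_L | in_node w rho l s (list1 I i)]|.
Definition nodeB (d L W r k N w : nat) (I : inst d L W)
    (rho : rep_rand d r k N) (l : nat) (s : pref r N) : nat :=
  #|[set j : 'I_L | in_node w rho l s (list2 I j)]|.

(* Running time of one repetition:
   - applying pi to all 2L vectors (d steps each);
   - creating the root (1 step);
   - creating every node at level l+1 (1 step) by scanning the two lists
     of its parent (|A| + |B| steps);
   - at every leaf, comparing all |A| * |B| pairs (d steps each). *)
Definition rep_cost (d L W r k N w : nat) (I : inst d L W)
    (rho : rep_rand d r k N) : nat :=
  d * (2 * L) + 1
  + \sum_(l < r) \sum_(s : pref r N | is_node l.+1 s)
       (1 + nodeA w I rho l (parent l s) + nodeB w I rho l (parent l s))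
  + \sum_(s : pref r N | is_node r s) d * (nodeA w I rho r s * nodeB w I rho r s).

Definition omega (d L W r k N P : nat) :=
  (inst d L W * {ffun 'I_P -> rep_rand d r k N})%type.

Definition success (d L W r k N P w : nat) (o : omega d L W r k N P) : bool :=
  [exists t : 'I_P, rep_outputs w o.1 (o.2 t) (planted_x o.1) (planted_y o.1)].

Definition total_cost (d L W r k N P w : nat) (o : omega d L W r k N P) : nat :=
  \sum_(t < P) rep_cost w o.1 (o.2 t).

Definition Psucc (d L W r k N P w : nat) : R :=
  Rdiv (INR #|[set o : omega d L W r k N P | success w o]|)
       (INR #|{: omega d L W r k N P}|).

Definition Ecost (d L W r k N P w : nat) : R :=
  Rdiv (INR (\sum_(o : omega d L W r k N P) total_cost w o))
       (INR #|{: omega d L W r k N P}|).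

Local Open Scope R_scope.

Definition log2 (x : R) : R := ln x / ln 2.

(* p = C(k, w) 2^-k   with w = delta k *)
Definition p_par (k w : nat) : R := INR 'C(k, w) / 2 ^ k.
(* q = C(2h, h) C(k - 2h, w - h) 2^-k   with 2h = gamma k, w = delta k *)
Definition q_par (k h w : nat) : R :=
  (INR ('C(2 * h, h) * 'C(k - 2 * h, w - h)) / 2 ^ k).

Definition L_par (lam : R) (d : nat) : nat :=
  Z.to_nat (Int_part (Rpower 2 (lam * INR d))).
Definition N_par (d k h w : nat) : nat := Z.to_nat (up (INR d / q_par k h w)).
Definition P_par (d r : nat) : nat := (d.+1 ^ r.+1)%N.

Definition T_par (lam : R) (d r k h w : nat) : R :=
  Rmax (Rmax (/ q_par k h w ^ r)
             (Rpower 2 (lam * INR d) * p_par k w ^ (r - 1) / q_par k h w ^ r))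
       ((Rpower 2 (lam * INR d) * p_par k w ^ r) ^ 2 / q_par k h w ^ r).

(* Main.v *)
(** For a fixed instance, a random permutation spreads the [2 h r] differences of
    the planted pair evenly over the blocks with probability
    [C(k, 2h)^r / C(rk, 2hr) >= (k + 1)^-r], because [2h] is the mode of the
    corresponding binomial law.  Once they are spread, a filter retains both
    planted vectors with probability exactly [q], so a node containing both has,
    among its [N >= d / q] children, at least one that still does, except with
    probability [(1 - q)^N <= e^-d].  Hence one repetition succeeds with
    probability at least [(1 - r e^-d) (k + 1)^-r], and [(d + 1)^(r + 1)]
    independent ones all fail with probability at most [e^-d].
    For the cost, a fixed vector reaches a given node of level [l] with
    probability [p^l], and a non-planted pair reaches a given leaf with
    probability [p^(2r)].  This gives [T <= E <= d^(14 r) T], and the factor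
    [d^(14 r)] is absorbed since [T >= 2^(lam d)] while [r log d = o(d)]. *)

Require Import Defs.
From Stdlib Require Import Reals Lra Psatz.
From mathcomp Require Import all_boot all_order all_algebra fingroup perm.
From mathcomp Require Import zify ring lra Rstruct.

Set Implicit Arguments.
Unset Strict Implicit.
Unset Printing Implicit Defensive.

Import Order.TTheory GRing.Theory Num.Theory.
Local Open Scope ring_scope.

(** * Averages over finite types *)

Section Average.
Variable F : realFieldType.

Definition avg (T : finType) (f : T -> F) : F := (\sum_x f x) / #|T|%:R.

Lemma eq_avg (T : finType) (f g : T -> F) : f =1 g -> avg f = avg g.
Proof. by move=> fg; rewrite /avg (eq_bigr g). Qed.

Lemma ler_avg (T : finType) (f g : T -> F) :
  (forall x, f x <= g x) -> avg f <= avg g.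
Proof.
by move=> fg; rewrite ler_wpM2r ?invr_ge0 ?ler0n // ler_sum // => x _; apply: fg.
Qed.

Lemma avg_cst (T : finType) (c : F) : (0 < #|T|)%N -> avg (fun _ : T => c) = c.
Proof.
move=> T0; rewrite /avg sumr_const -[c *+ _]mulr_natr mulfK // pnatr_eq0.
by rewrite -lt0n.
Qed.

Lemma avg_ge (T : finType) (c : F) (f : T -> F) :
  (0 < #|T|)%N -> (forall x, c <= f x) -> c <= avg f.
Proof. by move=> T0 cf; rewrite -[c](avg_cst _ T0) ler_avg. Qed.

Lemma avg_le (T : finType) (c : F) (f : T -> F) :
  (0 < #|T|)%N -> (forall x, f x <= c) -> avg f <= c.
Proof. by move=> T0 cf; rewrite -[leRHS](avg_cst _ T0) ler_avg. Qed.

Lemma avgD (T : finType) (f g : T -> F) :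
  avg (fun x => f x + g x) = avg f + avg g.
Proof. by rewrite /avg big_split mulrDl. Qed.

Lemma avgZ (T : finType) (c : F) (f : T -> F) :
  avg (fun x => c * f x) = c * avg f.
Proof. by rewrite /avg -mulr_sumr mulrA. Qed.

Lemma avg1B (T : finType) (f : T -> F) : (0 < #|T|)%N ->
  avg (fun x => 1 - f x) = 1 - avg f.
Proof.
move=> T0; rewrite avgD avg_cst //.
under eq_avg do rewrite -mulN1r.
by rewrite avgZ mulN1r.
Qed.

Lemma avg_sum (T I : finType) (P : pred I) (f : I -> T -> F) :
  avg (fun x => \sum_(i | P i) f i x) = \sum_(i | P i) avg (f i).
Proof. by rewrite /avg exchange_big mulr_suml. Qed.

Lemma exchange_avg (A B : finType) (f : A -> B -> F) :
  avg (fun a => avg (f a)) = avg (fun b => avg (f^~ b)).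
Proof.
by rewrite /avg -!mulr_suml exchange_big -!mulrA [X in _ * X]mulrC.
Qed.

Lemma avg_pair (A B : finType) (f : A * B -> F) :
  avg f = avg (fun a => avg (fun b => f (a, b))).
Proof.
rewrite /avg -mulr_suml pair_big /= card_prod natrM -mulrA.
rewrite [X in _ = _ * X]mulrC -invfM; congr (_ / _).
by apply: eq_bigr => -[].
Qed.

Lemma avg_bij (A B : finType) (h : A -> B) (f : B -> F) :
  bijective h -> avg (f \o h) = avg f.
Proof.
move=> bh; rewrite /avg (bij_eq_card bh); congr (_ / _).
by rewrite [RHS](reindex h) //; apply: onW_bij.
Qed.

Lemma avg_ind (T : finType) (P : pred T) :
  avg (fun x => (P x)%:R) = #|[set x | P x]|%:R / #|T|%:R.
Proof. by rewrite /avg -natr_sum -sum1dep_card [in RHS]big_mkcond. Qed.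

Lemma avg_ind_ge0 (T : finType) (P : pred T) : 0 <= avg (fun x => (P x)%:R).
Proof. by rewrite avg_ind divr_ge0. Qed.

Lemma avg_ind_le1 (T : finType) (P : pred T) :
  (0 < #|T|)%N -> avg (fun x => (P x)%:R) <= 1.
Proof. by move=> T0; apply: avg_le => // x; rewrite lern1 leq_b1. Qed.

(** * Independence of the values of a uniformly random function *)

Section Product.
Variables K V : finType.
Hypothesis V0 : (0 < #|V|)%N.

Lemma card_ffun_gt0 : (0 < #|{ffun K -> V}|)%N.
Proof. by rewrite card_ffun expn_gt0 V0. Qed.

(** Distributivity turns a sum over all functions of a product into a product of sums: the values of
    a uniformly random function are independent. *)
Lemma avg_prodK (G : K -> V -> F) :
  avg (fun Z : {ffun K -> V} => \prod_k G k (Z k)) = \prod_k avg (G k).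
Proof.
rewrite /avg -bigA_distr_bigA big_split /= prodfV; congr (_ * _^-1).
by rewrite prodr_const card_ffun natrX.
Qed.

(** Grouping the factors by key leaves at most one factor per key, and keys outside the image of
    [kappa] contribute 1. This form serves both for the filters along one path and for those of
    siblings. *)
Lemma avg_prod (J : finType) (kappa : J -> K) (G : J -> V -> F) :
  injective kappa ->
  avg (fun Z : {ffun K -> V} => \prod_j G j (Z (kappa j)))
  = \prod_j avg (G j).
Proof.
move=> kI; transitivity (\prod_k avg (fun v => \prod_(j | kappa j == k) G j v)).
  rewrite -avg_prodK; apply: eq_avg => Z.
  rewrite (partition_big kappa predT) //=; apply: eq_bigr => k _.
  by apply: eq_bigr => j /eqP ->.
rewrite [RHS](partition_big kappa predT) //=; apply: eq_bigr => k _.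
have [j /eqP <-|nk] := pickP (fun j => kappa j == k).
  rewrite (big_pred1 j) => [|i]; last by rewrite (inj_eq kI).
  by apply: eq_avg => v; rewrite (big_pred1 j) // => i; rewrite (inj_eq kI).
rewrite big_pred0 //; under eq_avg do rewrite big_pred0 //.
by rewrite avg_cst.
Qed.

Lemma avg_eval (k : K) (g : V -> F) :
  avg (fun Z : {ffun K -> V} => g (Z k)) = avg g.
Proof.
have := @avg_prod unit (fun=> k) (fun=> g); rewrite big_const card_unit /= mulr1.
by move=> <- => [|[] [] //]; apply: eq_avg => Z; rewrite big_const card_unit /= mulr1.
Qed.

Lemma avg_eval2 (k1 k2 : K) (g1 g2 : V -> F) : k1 != k2 ->
  avg (fun Z : {ffun K -> V} => g1 (Z k1) * g2 (Z k2)) = avg g1 * avg g2.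
Proof.
move=> k12; have := @avg_prod bool (fun b => if b then k1 else k2)
  (fun b => if b then g1 else g2); rewrite big_bool /= => <-.
  by apply: eq_avg => Z; rewrite big_bool.
by move=> [] [] // /eqP; rewrite 1?[k2 == _]eq_sym (negbTE k12).
Qed.

(* Resampling: replacing the values of [Z] on [S] by fresh independent ones
   does not change its law. *)
Definition mix (S : pred K) (Z Z' : {ffun K -> V}) : {ffun K -> V} :=
  [ffun k => if S k then Z' k else Z k].

Lemma avg_mix (S : pred K) (f : {ffun K -> V} -> F) :
  avg f = avg (fun Z => avg (fun Z' => f (mix S Z Z'))).
Proof.
transitivity (avg (fun p : {ffun K -> V} * {ffun K -> V} => f p.1)).
  rewrite avg_pair; apply: eq_avg => Z /=.
  by rewrite avg_cst ?card_ffun_gt0.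
rewrite -[RHS](avg_pair (fun p => f (mix S p.1 p.2))).
(* Exchanging the two functions on [S] is an involution of the pairs, hence preserves the uniform
   law. *)
pose h (p : {ffun K -> V} * {ffun K -> V}) := (mix S p.1 p.2, mix S p.2 p.1).
have hK : involutive h.
  by move=> [Z Z']; congr pair; apply/ffunP => k; rewrite !ffunE /=; case: (S k).
by rewrite -(avg_bij _ (inv_bij hK)).
Qed.

End Product.
End Average.

(** * Binomial coefficients and Hamming spheres *)

Local Open Scope nat_scope.

Section BinomialBounds.

(* Up to the factor [n ^ n], the summands below are the probabilities of the
   binomial law of parameters n and m / n, whose mode is m. *)
Lemma binomial_mode (n m j : nat) : m <= n -> j <= n ->
  'C(n, j) * (m ^ j * (n - m) ^ (n - j)) <= 'C(n, m) * (m ^ m * (n - m) ^ (n - m)).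
Proof.
pose a j := 'C(n, j) * (m ^ j * (n - m) ^ (n - j)).
move=> mn jn; rewrite -[X in X <= _]/(a j) -[X in _ <= X]/(a m).
(* The ratio of consecutive terms, cross-multiplied to stay in the naturals: it is at least 1 before
   [m] and at most 1 from [m] on. *)
have step i : i < n -> a i.+1 * (i.+1 * (n - m)) = a i * ((n - i) * m).
  move=> lin; rewrite /a expnS -(subnSK lin) expnS subnSK //.
  have := mul_bin_left n i; set c := 'C(n, i.+1); set b := 'C(n, i) => cb.
  transitivity ((i.+1 * c) * (m * m ^ i * ((n - m) ^ (n - i.+1) * (n - m)))); first by ring.
  by rewrite cb; ring.
have [jm|mj] := leqP j m.
  have up i : i <= m - j -> a j <= a (j + i).
    elim: i => [|i IHi] lti; first by rewrite addn0.
    apply: leq_trans (IHi (ltnW lti)) _; rewrite addnS.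
    have lin : j + i < n by lia.
    (* For [m = n] the factor [n - m] vanishes and cannot be cancelled, but then the smaller term is
       itself 0. *)
    have [mE|nm] := eqVneq m n.
      by rewrite {1}/a mE subnn exp0n ?muln0 // subn_gt0.
    have := step _ lin; have : (j + i).+1 * (n - m) <= (n - (j + i)) * m by nia.
    have : 0 < (j + i).+1 * (n - m) by rewrite muln_gt0 /=; lia.
    set u := _.+1 * _; set v := _ * m; move=> u0 uv E.
    by rewrite -(leq_pmul2r u0) E leq_mul2l uv orbT.
  by have := up (m - j) (leqnn _); rewrite subnKC.
have down i : m + i <= n -> a (m + i) <= a m.
  elim: i => [|i IHi] lti; first by rewrite addn0.
  apply: leq_trans (IHi _); last by lia.
  rewrite addnS; have lin : m + i < n by lia.
  have := step _ lin; have : (n - (m + i)) * m <= (m + i).+1 * (n - m) by nia.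
  have : 0 < (m + i).+1 * (n - m) by rewrite muln_gt0 /=; lia.
  set u := _.+1 * _; set v := _ * m; move=> u0 uv E.
  by rewrite -(leq_pmul2r u0) E leq_mul2l uv orbT.
by have := down (j - m); rewrite subnKC ?(ltnW mj) //; apply.
Qed.

(** The left side is a single term of the expansion of [((n - m) + m) ^ n]. *)
Lemma binomial_entropy_le (n m : nat) : m <= n ->
  'C(n, m) * (m ^ m * (n - m) ^ (n - m)) <= n ^ n.
Proof.
move=> mn; have -> : n ^ n = ((n - m) + m) ^ n by rewrite subnK.
rewrite expnDn (bigD1 (Ordinal (mn : m < n.+1))) //= [m ^ m * _]mulnC.
exact: leq_addr.
Qed.

(** The same expansion has [n + 1] terms, none larger than the one at the mode [m]. *)
Lemma binomial_entropy_ge (n m : nat) : m <= n ->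
  n ^ n <= n.+1 * 'C(n, m) * (m ^ m * (n - m) ^ (n - m)).
Proof.
move=> mn; have -> : n ^ n = ((n - m) + m) ^ n by rewrite subnK.
rewrite expnDn -mulnA -[X in X * _]card_ord -sum_nat_const.
apply: leq_sum => i _; rewrite [_ * m ^ i]mulnC; apply: binomial_mode => //.
by rewrite -ltnS.
Qed.

(** Both coefficients have the same ratio [m / k], hence the same entropy per coordinate: the upper
    entropy bound for length [r * k] is compared with the [r]-th power of the lower one for length
    [k], and the powers of [r] cancel. *)
Lemma binomial_blocks (r k m : nat) : 0 < r -> m <= k ->
  'C(r * k, m * r) <= (k.+1 * 'C(k, m)) ^ r.
Proof.
move=> r0 mk; rewrite [m * r]mulnC.
set B := m ^ m * (k - m) ^ (k - m).
have B0 : 0 < B by rewrite muln_gt0 !expn_gt0; lia.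
have D0 : 0 < r ^ (r * k) * B ^ r by rewrite muln_gt0 !expn_gt0 r0 B0.
rewrite -(leq_pmul2r D0).
have DE : r ^ (r * k) * B ^ r = (r * m) ^ (r * m) * (r * k - r * m) ^ (r * k - r * m).
  rewrite -mulnBr !expnMn mulnACA -expnD -mulnDr subnKC //.
  by rewrite -!expnM ![_ * r]mulnC.
rewrite {1}DE; apply: leq_trans (binomial_entropy_le _) _; first by rewrite leq_mul2l mk orbT.
rewrite mulnCA -expnMn expnMn leq_mul2l.
by rewrite [k ^ _]expnM -expnAC leq_exp2r // binomial_entropy_ge ?orbT.
Qed.

End BinomialBounds.

(** A set amounts to its traces on [E] and on the complement, chosen independently. *)
Lemma card_set_split (T : finType) (E : {set T}) (a b : nat) :
  #|[set A : {set T} | (#|A :&: E| == a) && (#|A :\: E| == b)]|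
  = 'C(#|E|, a) * 'C(#|~: E|, b).
Proof.
rewrite -!cards_draws -cardsX.
pose f (A : {set T}) := (A :&: E, A :\: E).
have fI : injective f by move=> A B [AB1 AB2]; rewrite -(setID A E) AB1 AB2 setID.
rewrite -(card_imset _ fI); apply: eq_card => -[A1 A2]; rewrite !inE /=.
apply/imsetP/andP => [[A]|].
  by rewrite inE => /andP[ca cb] [-> ->]; rewrite ca cb subsetIr subDset setUCr subsetT.
move=> [/andP[s1 c1] /andP[s2 c2]].
have d2 : A2 :&: E = set0 by apply: disjoint_setI0; rewrite disjoints_subset.
have e1 : (A1 :|: A2) :&: E = A1.
  by rewrite setIUl d2 setU0; apply/setIidPl.
have e2 : (A1 :|: A2) :\: E = A2.
  rewrite setDUl; move: (s1); rewrite -setD_eq0 => /eqP ->.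
  by rewrite set0U setDE; apply/setIidPl.
by exists (A1 :|: A2); rewrite ?inE /f e1 e2 ?c1.
Qed.

(** * Hamming spheres and their pairwise intersections *)

Definition hdist (k : nat) (x z : bvec k) : nat := #|[set j | x j != z j]|.

Section HammingSpheres.
Variable k : nat.
Implicit Types x y z : bvec k.

Definition bset (z : bvec k) : {set 'I_k} := [set j | z j].

Lemma bset_bij : bijective bset.
Proof.
pose g (A : {set 'I_k}) : bvec k := [ffun j => j \in A].
exists g => [z|A].
  by apply/ffunP => j; rewrite ffunE inE.
by apply/setP => j; rewrite inE ffunE.
Qed.

Lemma bxorK x : involutive (bxor x).
Proof. by move=> z; apply/ffunP => j; rewrite !ffunE addKb. Qed.

Lemma hdistC x z : hdist x z = hdist z x.
Proof. by apply: eq_card => j; rewrite !inE eq_sym. Qed.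

Lemma hdistE x z : hdist x z = wt (bxor x z).
Proof. by apply: eq_card => j; rewrite !inE ffunE; case: (x j); case: (z j). Qed.

Lemma card_wt m : #|[set z : bvec k | wt z == m]| = 'C(k, m).
Proof.
rewrite -(card_ord k) -card_draws card_ord.
rewrite -(on_card_preimset (f := bset)); last exact: onW_bij _ bset_bij.
by apply: eq_card => z; rewrite !inE.
Qed.

Lemma card_sphere x w : #|[set z | hdist x z == w]| = 'C(k, w).
Proof.
rewrite -(card_wt w) -(card_imset _ (inv_inj (bxorK x))).
apply: eq_card => z; rewrite inE; apply/imsetP/eqP => [[y]|wz].
  by rewrite inE => /eqP <- ->; rewrite hdistE.
by exists (bxor x z); rewrite ?bxorK // inE hdistE bxorK wz.
Qed.

(** Translate by [x] and let [E] be the set where [x] and [y] differ. A translated [z] has distance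
    |z in E| + |z off E| to [x] and 2h - |z in E| + |z off E| to [y]; both equal [w] exactly when it
    has [h] ones in [E] and [w - h] outside. *)
Lemma card_sphere2 x y h w : h <= w -> hdist x y = 2 * h ->
  #|[set z | (hdist x z == w) && (hdist y z == w)]|
  = 'C(2 * h, h) * 'C(k - 2 * h, w - h).
Proof.
move=> hw xy; pose E := bset (bxor x y).
have cE : #|E| = 2 * h by rewrite -xy hdistE.
have -> : k - 2 * h = #|~: E| by rewrite -cE [RHS]cardsCs setCK card_ord.
rewrite -{1}cE -card_set_split -(card_imset _ (inv_inj (bxorK x))).
rewrite -(on_card_preimset (f := bset)); last exact: onW_bij _ bset_bij.
apply: eq_card => z; rewrite !inE.
have dist_split : hdist x (bxor x z) = #|bset z :&: E| + #|bset z :\: E|.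
  by rewrite hdistE bxorK cardsID.
have dist2_split : hdist y (bxor x z) + #|bset z :&: E| = 2 * h + #|bset z :\: E|.
  rewrite -cE -(cardsID (bset z) E) setIC [RHS]addnAC addnC -addnA; congr addn.
  have dj : (bset z :\: E) :&: (E :\: bset z) = set0.
    by apply/setP => j; rewrite !inE; case: (z j); rewrite /= ?andbF.
  rewrite -cardsUI dj cards0 addn0.
  by apply: eq_card => j; rewrite !inE !ffunE; case: (x j) (y j) (z j) => [] [] [].
apply/imsetP/andP => [[u]|[/eqP c1 /eqP c2]].
  rewrite inE => /andP[/eqP u1 /eqP u2] zE.
  have uE : u = bxor x z by rewrite zE bxorK.
  by split; apply/eqP; move: dist_split dist2_split; rewrite -uE u1 u2; lia.
exists (bxor x z); rewrite ?bxorK // inE.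
by apply/andP; split; apply/eqP; lia.
Qed.

(** One term of Vandermonde's convolution; it yields q <= p. *)
Lemma bin_split_le h w : h <= w -> 2 * h <= k ->
  'C(2 * h, h) * 'C(k - 2 * h, w - h) <= 'C(k, w).
Proof.
move=> hw hk; rewrite -[in leqRHS](subnKC hk) -binomial.Vandermonde.
have hw1 : h < w.+1 by [].
by rewrite (bigD1 (Ordinal hw1)) //= leq_addr.
Qed.

End HammingSpheres.

(** * Blocks of a permuted vector and balanced differences *)

Section Blocks.
Variables r k : nat.
Notation d := (r * k).

(** The permuted vector recoded as an [r]-tuple of blocks, so that the filter creating a node at
    level [b + 1] reads only component [b]. *)
Definition blk (pi : {perm 'I_d}) (v : bvec d) : {ffun 'I_r -> bvec k} :=
  [ffun b : 'I_r => [ffun j : 'I_k => vat (pvec pi v) (b * k + j)]].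

Lemma inbucketE pi (b : 'I_r) z w v :
  inbucket pi b z w v = (hdist (blk pi v b) z == w).
Proof.
by congr (_ == _); apply: eq_card => j; rewrite !inE !ffunE.
Qed.

Lemma vatE (v : bvec d) (i : 'I_d) : vat v i = v i.
Proof. by rewrite /vat insubT //= => ltid; congr (v _); apply: val_inj. Qed.

Lemma blk_inj pi : injective (blk pi).
Proof.
move=> u v /ffunP uv; apply/ffunP => i0; rewrite -[i0](permKV pi).
move: (pi^-1%g i0) => i.
have k0 : 0 < k by case: (k) (i) => [[m]|//]; rewrite muln0.
have bP : i %/ k < r by rewrite ltn_divLR.
have jP : i %% k < k by rewrite ltn_mod.
have := uv (Ordinal bP); move/ffunP/(_ (Ordinal jP)); rewrite !ffunE /=.
by rewrite -divn_eq !vatE !ffunE.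
Qed.

Lemma blk_bij pi : bijective (blk pi).
Proof.
apply: inj_card_bij (@blk_inj pi) _.
by rewrite !card_ffun !card_ord -expnM mulnC.
Qed.

Lemma blk_bxor pi u v b : blk pi (bxor u v) b = bxor (blk pi u b) (blk pi v b).
Proof.
apply/ffunP => j; rewrite !ffunE /vat; case: insub => //= i; by rewrite !ffunE.
Qed.

Definition balanced (m : nat) (pi : {perm 'I_d}) (e : bvec d) : bool :=
  [forall b, wt (blk pi e b) == m].

(** Through the bijection [blk pi], balanced vectors are tuples of freely chosen blocks of weight
    [m]. *)
Lemma card_balanced (m : nat) pi : #|[set e | balanced m pi e]| = 'C(k, m) ^ r.
Proof.
rewrite -(card_wt k m) -[in RHS](card_ord r) -card_ffun_on.
rewrite -(on_card_preimset (f := blk pi) (R := mem (ffun_on _))).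
  apply: eq_card => e; rewrite !inE; apply/forallP/ffun_onP => H b.
    by rewrite inE H.
  by have := H b; rewrite inE.
exact: onW_bij _ (blk_bij pi).
Qed.

Lemma wt_count n (v : bvec n) : wt v = count id (codom v).
Proof.
rewrite /wt cardE size_filter codomE count_map -enumT.
by apply: eq_count => i; rewrite /= inE.
Qed.

(** The weight determines how often each boolean occurs, so the two tuples of entries are
    rearrangements of each other. *)
Lemma perm_same_wt n (u v : bvec n) : wt u = wt v ->
  exists s : {perm 'I_n}, forall i, u i = v (s i).
Proof.
move=> uv; pose t (x : bvec n) := [tuple x i | i < n].
have /tuple_permP[s st] : perm_eq (t u) (t v).
  apply/allP => b _ /=.
  have cntE (x : bvec n) : count id (t x) = wt x.
    by rewrite wt_count codomE.
  have cntN (x : bvec n) : count negb (t x) = n - wt x.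
    by rewrite -cntE -[X in _ = X - _](size_tuple (t x)) -(count_predC id (t x)) addKn.
  suff cb (x : bvec n) : count_mem b (t x) = if b then wt x else n - wt x.
    by rewrite !cb uv.
  by case: b; [rewrite -cntE | rewrite -cntN]; apply: eq_count => -[].
exists s => i; have /(congr1 (fun x : seq bool => nth false x i)) := st.
have nE (f : 'I_n -> bool) : nth false [seq f j | j <- enum 'I_n] i = f i.
  by rewrite (nth_map i) ?size_enum_ord // nth_ord_enum.
by rewrite /= !nE tnth_mktuple.
Qed.

End Blocks.

Section BalancedWeight.
Variables r k : nat.
Notation d := (r * k)%N.

Lemma ltn_blk_idx (b : 'I_r) (j : 'I_k) : (b * k + j < d)%N.
Proof.
apply: (@leq_trans (b.+1 * k)); first by rewrite mulSn addnC ltn_add2r.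
by rewrite leq_mul2r ltn_ord orbT.
Qed.

Definition blk_idx (bj : 'I_r * 'I_k) : 'I_d := Ordinal (ltn_blk_idx bj.1 bj.2).

Lemma blk_idx_bij : bijective blk_idx.
Proof.
apply: inj_card_bij; last by rewrite card_prod !card_ord.
move=> [b j] [b' j'] /(congr1 val) /= E.
have k0 : (0 < k)%N by apply: leq_trans (ltn_ord j).
congr pair; apply: val_inj => /=.
  by have := congr1 (divn^~ k) E; rewrite !divnMDl // !divn_small // !addn0.
by have := congr1 (modn^~ k) E; rewrite !modnMDl !modn_small.
Qed.

Lemma wt_sum n (v : bvec n) : wt v = (\sum_i v i)%N.
Proof. by rewrite /wt -sum1dep_card big_mkcond; apply: eq_bigr => i _; case: (v i). Qed.

Lemma wt_blk (pi : {perm 'I_d}) (v : bvec d) : wt v = (\sum_b wt (blk pi v b))%N.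
Proof.
rewrite wt_sum (reindex_inj (@perm_inj _ pi)) /=.
rewrite (reindex _ (onW_bij _ blk_idx_bij)) /=.
under [RHS]eq_bigr do rewrite wt_sum.
rewrite pair_big; apply: eq_bigr => -[b j] _; congr nat_of_bool.
by rewrite !ffunE -[(b * k + j)%N]/(val (blk_idx (b, j))) vatE ffunE.
Qed.

Lemma balanced_wt m (pi : {perm 'I_d}) (e : bvec d) :
  balanced m pi e -> wt e = (m * r)%N.
Proof.
move/forallP => be; rewrite (wt_blk pi) (eq_bigr (fun=> m)) => [|b _].
  by rewrite sum_nat_const card_ord mulnC.
exact/eqP/be.
Qed.

End BalancedWeight.

Local Open Scope ring_scope.

(** * One repetition of the algorithm *)

Section Probability.
Variable F : realFieldType.

Lemma natr_forall (T : finType) (P : pred T) :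
  ([forall x, P x]%:R : F) = \prod_x (P x)%:R.
Proof.
have [/forallP Px|] := boolP [forall x, P x].
  by rewrite big1 // => x _; rewrite Px.
by rewrite negb_forall => /existsP[x /negbTE Px]; rewrite (bigD1 x) //= Px mul0r.
Qed.

Lemma natr_negb (b : bool) : (~~ b)%:R = 1 - b%:R :> F.
Proof. by case: b; rewrite ?subrr ?subr0. Qed.

Lemma natr_andb (a b : bool) : (a && b)%:R = a%:R * b%:R :> F.
Proof. by case: a b => [] []; rewrite ?mul0r ?mulr1 ?mulr0. Qed.

Lemma ler_natb (a b : bool) : (a -> b) -> a%:R <= b%:R :> F.
Proof. by case: a b => [] [] // ab; rewrite ?lexx ?ler01 //; have := ab isT. Qed.

Lemma card_bvec n : #|{: bvec n}| = (2 ^ n)%N.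
Proof. by rewrite card_ffun card_bool card_ord. Qed.

Lemma card_bvec_gt0 n : (0 < #|{: bvec n}|)%N.
Proof. by rewrite card_bvec expn_gt0. Qed.

Definition pr_filter (k w : nat) : F := 'C(k, w)%:R / (2 ^ k)%:R.
Definition pr_filter2 (k h w : nat) : F :=
  ('C(2 * h, h) * 'C(k - 2 * h, w - h))%:R / (2 ^ k)%:R.

Lemma avg_sphere k w (x : bvec k) :
  avg (fun z => (hdist x z == w)%:R) = pr_filter k w.
Proof. by rewrite avg_ind card_sphere card_bvec. Qed.

Lemma avg_sphere2 k h w (x y : bvec k) : (h <= w)%N -> hdist x y = (2 * h)%N ->
  avg (fun z => ((hdist x z == w) && (hdist y z == w))%:R) = pr_filter2 k h w.
Proof. by move=> hw xy; rewrite avg_ind (card_sphere2 hw xy) card_bvec. Qed.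

Lemma pr_filter_ge0 k w : 0 <= pr_filter k w.
Proof. by rewrite divr_ge0. Qed.

Lemma pr_filter_le1 k w : pr_filter k w <= 1.
Proof.
by rewrite -(avg_sphere w [ffun=> false]) avg_ind_le1 ?card_bvec_gt0.
Qed.

Lemma pr_filter2_gt0 k h w : (h <= w)%N -> (2 * w <= k)%N -> 0 < pr_filter2 k h w.
Proof.
move=> hw wk; rewrite divr_gt0 // ltr0n ?expn_gt0 // muln_gt0 !bin_gt0.
by apply/andP; split; lia.
Qed.

Lemma pr_filter2_le k h w : (h <= w)%N -> (2 * w <= k)%N ->
  pr_filter2 k h w <= pr_filter k w.
Proof.
move=> hw wk; rewrite ler_wpM2r ?invr_ge0 ?ler0n // ler_nat.
by apply: bin_split_le => //; lia.
Qed.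

(* Permutations act transitively on the vectors of a given weight, so the
   probability is that of a uniformly random vector of the weight of [e]. *)
Lemma pr_balanced (r k m : nat) (e : bvec (r * k)) : (0 < r)%N -> (m <= k)%N ->
  wt e = (m * r)%N ->
  (k.+1 ^ r)%:R^-1 <= avg (fun pi => (balanced m pi e)%:R : F).
Proof.
move=> r0 mk we; pose f (e : bvec (r * k)) := avg (fun pi => (balanced m pi e)%:R : F).
have f_wt u v : wt u = wt v -> f u = f v.
  move=> /perm_same_wt[s us]; rewrite /f.
  have sI : injective (fun pi : {perm 'I_(r * k)} => (pi * s)%g) by exact: mulIg.
  rewrite -[RHS](avg_bij _ (injF_bij sI)); apply: eq_avg => pi /=; congr (_%:R).
  congr nat_of_bool; apply: eq_forallb => b; congr (_ == _); congr wt.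
  apply/ffunP => j; rewrite !ffunE; congr (vat _ _).
  by apply/ffunP => i; rewrite !ffunE permM us.
(* Double counting of the balanced pairs of a permutation and a vector. By permutation: each
   balances C(k, m)^r vectors, all of which have weight [m * r]. *)
have sumE : \sum_(v | wt v == (m * r)%N) f v = ('C(k, m) ^ r)%:R.
  rewrite -avg_sum -(avg_cst ('C(k, m) ^ r)%:R (T := {perm 'I_(r * k)})); last first.
    by apply/card_gt0P; exists 1%g.
  apply: eq_avg => pi; rewrite -(card_balanced m pi) -sum1_card natr_sum.
  rewrite big_mkcond [RHS]big_mkcond; apply: eq_bigr => v _; rewrite inE.
  have [/balanced_wt ->|_] := boolP (balanced m pi v); first by rewrite eqxx.
  by rewrite if_same.
(* By vector: all C(rk, mr) terms are equal to [f e]. *)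
have : \sum_(v | wt v == (m * r)%N) f v = 'C(r * k, m * r)%:R * f e.
  rewrite (eq_bigr (fun=> f e)) => [|v /eqP wv]; last by apply: f_wt; rewrite wv.
  rewrite sumr_const -[f e *+ _]mulr_natl -card_wt; congr (_%:R * _).
  by apply: eq_card => v; rewrite !inE.
rewrite sumE => E; have := binomial_blocks r0 mk; rewrite expnMn => le.
have B0 : (0 < 'C(r * k, m * r))%N by rewrite bin_gt0 mulnC leq_mul2l mk orbT.
rewrite -[X in _ <= X]/(f e) -div1r ler_pdivrMr ?ltr0n ?expn_gt0 //.
rewrite -(ler_pM2l (_ : 0 < 'C(r * k, m * r)%:R)) ?ltr0n // mulr1 mulrA -E -natrM.
by rewrite ler_nat [('C(k, m) ^ r * _)%N]mulnC.
Qed.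

(** * The filter tree and the survival of the planted pair *)

Section Tree.
Variables r k N w : nat.
Notation d := (r * k)%N.
Implicit Types (rho : rep_rand d r k N) (pi : {perm 'I_d}) (v : bvec d).
Implicit Types (s : pref r N) (Z : {ffun 'I_r * pref r N -> bvec k}).
Local Notation p := (pr_filter k w).

Lemma in_nodeE rho l s v : in_node w rho l s v =
  [forall m : 'I_r, (m < l)%N ==> (hdist (blk rho.1 v m) (rho.2 (m, trunc m s)) == w)].
Proof. by apply: eq_forallb => m; rewrite inbucketE. Qed.

(** Keys record their level, so the filters along one path are independent. *)
Lemma trunc_key_inj (s : pref r N) : injective (fun m : 'I_r => (m, trunc m s)).
Proof. by move=> m m' []. Qed.

Lemma prod_prefix l (c : F) : (l <= r)%N ->
  \prod_(m < r) (if (m < l)%N then c else 1) = c ^+ l.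
Proof.
by move=> lr; rewrite -big_mkcond (big_ord_narrow lr) prodr_const card_ord.
Qed.

Lemma avg_in_node pi l s v : (l <= r)%N ->
  avg (fun Z => (in_node w (pi, Z) l s v)%:R) = p ^+ l.
Proof.
move=> lr; rewrite -(prod_prefix p lr).
pose G (m : 'I_r) (z : bvec k) : F := ((m < l)%N ==> (hdist (blk pi v m) z == w))%:R.
transitivity (avg (fun Z => \prod_m G m (Z (m, trunc m s)))).
  by apply: eq_avg => Z; rewrite in_nodeE natr_forall.
rewrite (avg_prod (card_bvec_gt0 k) G (@trunc_key_inj s)).
apply: eq_bigr => m _; rewrite /G; case: ifP => _ /=; first exact: avg_sphere.
by rewrite avg_cst ?card_bvec_gt0.
Qed.

(** Here the filters are fixed and the vector is random: [blk] turns a uniform vector into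
    independent uniform blocks. Averaging in this order lets two independent vectors be treated
    under the same filters. *)
Lemma avg_in_leaf rho s :
  avg (fun v => (in_node w rho r s v)%:R) = p ^+ r.
Proof.
pose G (m : 'I_r) (z : bvec k) : F := (hdist z (rho.2 (m, trunc m s)) == w)%:R.
transitivity (avg (fun Y : {ffun 'I_r -> bvec k} => \prod_m G m (Y m))).
  rewrite -(avg_bij _ (blk_bij rho.1)); apply: eq_avg => v.
  rewrite in_nodeE natr_forall; apply: eq_bigr => m _.
  by rewrite ltn_ord.
rewrite avg_prodK (eq_bigr (fun=> p)); first by rewrite prodr_const card_ord.
move=> m _; rewrite -(avg_sphere w (rho.2 (m, trunc m s))).
by apply: eq_avg => z; rewrite /G hdistC.
Qed.

Lemma trunc_id (s : pref r N) (m : 'I_r) : is_node m.+1 s -> trunc m s = s.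
Proof.
move/forallP => sm; apply/ffunP => i; rewrite ffunE; case: ifP => // im.
by have := sm i; rewrite ltnS im; case: (s i).
Qed.

Lemma card_nodes l : (l <= r)%N -> #|[set s : pref r N | is_node l s]| = (N ^ l)%N.
Proof.
move=> lr.
have -> : (N ^ l = \prod_(m < r) if (m < l)%N then N else 1)%N.
  by rewrite -big_mkcond (big_ord_narrow lr) prod_nat_const card_ord.
pose D (m : 'I_r) : {pred option 'I_N} := [pred o | (o != None) == (m < l)%N].
transitivity #|family D|.
  apply: eq_card => s; rewrite inE; apply/forallP/familyP => H m;
  by have := H m; rewrite ?inE.
rewrite card_family foldrE big_map big_enum; apply: eq_bigr => m _.
rewrite /D; case: ifP => _.
  transitivity #|predC1 (None : option 'I_N)|.
    by apply: eq_card => o; rewrite !inE eqb_id.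
  by rewrite cardC1 card_option card_ord.
by rewrite (@eq_card1 _ None) // => -[c|]; rewrite !inE.
Qed.

Definition child (s : pref r N) (l : 'I_r) (c : 'I_N) : pref r N :=
  [ffun m => if m == l then Some c else s m].

Lemma child_inj s l : injective (fun c => (l, child s l c)).
Proof. by move=> c c' [] /ffunP/(_ l); rewrite !ffunE eqxx => -[]. Qed.

Lemma child_node s (l : 'I_r) c : is_node l s -> is_node l.+1 (child s l c).
Proof.
move/forallP => sl; apply/forallP => m; rewrite ffunE ltnS leq_eqVlt.
have -> : (nat_of_ord m == l) = (m == l) by [].
by case: (eqVneq m l) => [->|ml] //=; rewrite (eqP (sl m)).
Qed.

Lemma trunc_child s (l m : 'I_r) c : (m < l)%N -> trunc m (child s l c) = trunc m s.
Proof.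
move=> ml; apply/ffunP => i; rewrite !ffunE; case: ifP => // im.
by rewrite -val_eqE ltn_eqF // (leq_ltn_trans im ml).
Qed.

Lemma in_node_child pi Z s (l : 'I_r) c v : is_node l s ->
  in_node w (pi, Z) l.+1 (child s l c) v =
  in_node w (pi, Z) l s v && (hdist (blk pi v l) (Z (l, child s l c)) == w).
Proof.
move=> sl; rewrite !in_nodeE /=; apply/forallP/andP => [H|[/forallP H1 H2] m].
  split; last by have := H l; rewrite leqnn trunc_id // child_node.
  apply/forallP => m; apply/implyP => ml; have := H m.
  by rewrite ltnS (ltnW ml) trunc_child.
rewrite ltnS leq_eqVlt; case: eqVneq => [/val_inj ->|_] /=.
  by rewrite trunc_id // child_node.
by apply/implyP => ml; rewrite trunc_child //; have := H1 m; rewrite ml.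
Qed.

Section Path.
Variables (h : nat) (pi : {perm 'I_d}) (x y : bvec d).
Hypotheses (hw : (h <= w)%N) (wk : (2 * w <= k)%N).
Hypothesis bal : balanced (2 * h) pi (bxor x y).
Local Notation q := (pr_filter2 k h w).

Definition survive (l : nat) Z : bool :=
  [exists s, [&& is_node l s, in_node w (pi, Z) l s x & in_node w (pi, Z) l s y]].

(* Given a node at level [l] containing both vectors, the filters of its children
   are fresh, and each of them retains both vectors with probability [q]. *)
Lemma avg_survive l : (l <= r)%N ->
  (1 - (1 - q) ^+ N) ^+ l <= avg (fun Z => (survive l Z)%:R).
Proof.
set a := 1 - _.
have q1 : q <= 1 by rewrite (le_trans (pr_filter2_le hw wk)) ?pr_filter_le1.
elim: l => [_|l IHl lr].
  rewrite expr0 -[leLHS](avg_cst _ (card_ffun_gt0 ('I_r * pref r N)%type (card_bvec_gt0 k))).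
  apply: ler_avg => Z; rewrite (_ : survive 0 Z) //; apply/existsP; exists [ffun=> None].
  by apply/and3P; split; apply/forallP => m; rewrite // ffunE.
pose l' := Ordinal lr.
(* Redraw the filters that create level [l + 1]. Membership in level-[l] nodes reads only earlier
   keys, so a surviving node can be chosen from [Z] before [Z'] is drawn. *)
rewrite exprS (avg_mix (card_bvec_gt0 k) (fun key => key.1 == l')).
apply: (@le_trans _ _ (a * avg (fun Z => (survive l Z)%:R))).
  rewrite ler_wpM2l ?IHl ?(ltnW lr) // subr_ge0 exprn_ile1 ?subr_ge0 //.
  rewrite lerBlDr lerDl; exact/ltW/pr_filter2_gt0.
rewrite -avgZ; apply: ler_avg => Z.
have [/existsP[s /and3P[sl sx sy]]|_] := boolP (survive l Z); last first.
  by rewrite mulr0 avg_ind_ge0.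
pose g (z : bvec k) := (hdist (blk pi x l') z == w) && (hdist (blk pi y l') z == w).
have gq : avg (fun z => (g z)%:R) = q.
  apply: avg_sphere2 => //; rewrite hdistE -blk_bxor.
  by have /forallP/(_ l')/eqP := bal.
(* The [N] siblings have distinct keys, so they all lose the pair with probability
   [(1 - q) ^+ N]. *)
rewrite mulr1; have -> : a = avg (fun Z' => 1 - \prod_c (~~ g (Z' (l', child s l' c)))%:R).
  rewrite avg1B ?card_ffun_gt0 ?card_bool //.
  rewrite (avg_prod _ (fun _ z => (~~ g z)%:R) (@child_inj s l')) ?card_bvec_gt0 //.
  rewrite prodr_const card_ord; congr (1 - _ ^+ _).
  by under eq_avg do rewrite natr_negb; rewrite avg1B ?card_bvec_gt0 // gq.
apply: ler_avg => Z'; rewrite -natr_forall -natr_negb ler_natb //.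
rewrite negb_forall => /existsP[c]; rewrite negbK => /andP[gx gy].
have mixE v : in_node w (pi, mix (fun key => key.1 == l') Z Z') l' s v
    = in_node w (pi, Z) l s v.
  rewrite !in_nodeE; apply: eq_forallb => m /=; rewrite [mix _ _ _ _]ffunE /=.
  by case: (eqVneq m l') => // ->; rewrite ltnn.
apply/existsP; exists (child s l' c); rewrite (@child_node s l' c sl) /=.
by rewrite !(@in_node_child pi _ s l' c _ sl) !mixE sx sy [mix _ _ _ _]ffunE eqxx gx gy.
Qed.

End Path.
End Tree.
End Probability.

(** * Success probability and expected cost *)

Section Algorithm.
Variable F : realFieldType.
Variables r k N w h L : nat.
Hypotheses (r0 : (0 < r)%N) (hw : (h <= w)%N) (wk : (2 * w <= k)%N) (L0 : (0 < L)%N).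
Notation d := (r * k)%N.
Notation W := (2 * h * r)%N.
Notation rep := (rep_rand d r k N).
Notation instance := (inst d L W).
Local Notation p := (pr_filter F k w).
Local Notation q := (pr_filter2 F k h w).

Lemma card_rep_gt0 : (0 < #|{: rep}|)%N.
Proof.
rewrite card_prod muln_gt0 card_ffun_gt0 ?card_bvec_gt0 // andbT.
by apply/card_gt0P; exists 1%g.
Qed.

Lemma card_lists_gt0 : (0 < #|{ffun 'I_L -> bvec d}|)%N.
Proof. by rewrite card_ffun_gt0 // card_bvec_gt0. Qed.

Lemma card_err_gt0 : (0 < #|{: {e : bvec d | wt e == W}}|)%N.
Proof.
rewrite card_sig (eq_card (B := [set e : bvec d | wt e == W])) => [|e]; last by rewrite inE.
by rewrite card_wt bin_gt0; nia.
Qed.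

Lemma card_instance_gt0 : (0 < #|{: instance}|)%N.
Proof. by rewrite !card_prod !card_ord !muln_gt0 L0 !card_lists_gt0 card_err_gt0. Qed.

(** Conditioning on the permutation separates the two factors: balance depends on [pi] alone, and
    for every balancing [pi] the survival bound holds over the filters. *)
Lemma avg_rep_outputs (I : instance) :
  (1 - (1 - q) ^+ N) ^+ r / (k.+1 ^ r)%:R
  <= avg (fun rho : rep => (rep_outputs w I rho (planted_x I) (planted_y I))%:R : F).
Proof.
set x := planted_x I; set y := planted_y I; set a := 1 - _.
have q1 : q <= 1 by rewrite (le_trans (pr_filter2_le F hw wk)) ?pr_filter_le1.
have a0 : 0 <= a.
  rewrite subr_ge0 exprn_ile1 ?subr_ge0 // lerBlDr lerDl.
  exact/ltW/pr_filter2_gt0.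
have xy : bxor x y = val I.2.
  by rewrite /y /planted_y /list2 ffunE eqxx bxorK.
have wxy : wt (bxor x y) = W by rewrite xy; apply/eqP; case: (I.2).
rewrite avg_pair /=.
apply: (@le_trans _ _ (avg (fun pi => a ^+ r * (balanced (2 * h) pi (bxor x y))%:R))).
  rewrite avgZ ler_wpM2l ?exprn_ge0 //; apply: pr_balanced => //; lia.
apply: ler_avg => pi; have [bal|_] := boolP (balanced _ _ _); last first.
  by rewrite mulr0 avg_ind_ge0.
rewrite mulr1; apply: le_trans (avg_survive F N hw wk bal (leqnn r)) _.
apply: ler_avg => Z; apply: ler_natb => /existsP[s /and3P[sr sx sy]].
apply/existsP; exists s; rewrite sr /=; apply/existsP; exists I.1.1.1.1.
by apply/existsP; exists I.1.1.1.2; rewrite !eqxx sx sy wxy eqxx.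
Qed.

(** For a fixed instance the repetitions are independent, so failure probabilities multiply; the
    bound on each is uniform in the instance. *)
Lemma pr_failure_le P :
  1 - avg (fun o : omega d L W r k N P => (success w o)%:R : F)
  <= (1 - (1 - (1 - q) ^+ N) ^+ r / (k.+1 ^ r)%:R) ^+ P.
Proof.
have O0 : (0 < #|{: omega d L W r k N P}|)%N.
  by rewrite card_prod muln_gt0 card_instance_gt0 card_ffun_gt0 // card_rep_gt0.
rewrite -avg1B // avg_pair; apply: avg_le => [|I]; first exact: card_instance_gt0.
pose out (rho : rep) := rep_outputs w I rho (planted_x I) (planted_y I).
rewrite (_ : avg _ = \prod_(t < P) avg (fun rho => (~~ out rho)%:R)); last first.
  rewrite -(avg_prodK (fun (_ : 'I_P) rho => (~~ out rho)%:R)).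
  apply: eq_avg => Z; rewrite -natr_negb -natr_forall; congr (nat_of_bool _)%:R.
  by rewrite negb_exists.
rewrite prodr_const card_ord lerXn2r ?nnegrE //.
- exact: avg_ind_ge0.
- rewrite subr_ge0 (le_trans (avg_rep_outputs I)) //.
  by rewrite avg_ind_le1 ?card_rep_gt0.
- under eq_avg do rewrite natr_negb.
  by rewrite avg1B ?card_rep_gt0 // lerD2l lerN2 avg_rep_outputs.
Qed.

(** Puts the error vector and the planted positions outermost, so that list entries can be averaged
    with these fixed. *)
Lemma avg_instance (g : instance -> F) :
  avg g = avg (fun e => avg (fun ij => avg (fun f1 => avg (fun f2 => g (ij, f1, f2, e))))).
Proof.
rewrite avg_pair exchange_avg; apply: eq_avg => e.
by rewrite !avg_pair.
Qed.

Lemma natr_card (T : finType) (Q : pred T) : #|[set x | Q x]|%:R = \sum_x (Q x)%:R :> F.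
Proof. by rewrite -natr_sum -sum1dep_card big_mkcond. Qed.

(* The [+ 1] accounts for the planted pair. *)
Lemma avg_leaf_pairs (rho : rep) s (i0 j0 : 'I_L) (e : {e : bvec d | wt e == W}) :
  (L ^ 2 - 1)%:R * p ^+ (2 * r)
  <= avg (fun f1 => avg (fun f2 => (nodeA w ((i0, j0, f1, f2, e) : instance) rho r s
                                * nodeB w ((i0, j0, f1, f2, e) : instance) rho r s)%:R : F))
  <= (L ^ 2)%:R * p ^+ (2 * r) + 1.
Proof.
pose inn v : F := (in_node w rho r s v)%:R.
pose B i (f1 f2 : {ffun 'I_L -> bvec d}) : F :=
  inn (f1 i.1) * inn (list2 ((i0, j0, f1, f2, e) : instance) i.2).
have B01 i f1 f2 : 0 <= B i f1 f2 <= 1.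
  by rewrite /B /inn -natr_andb ler0n lern1 leq_b1.
rewrite (_ : avg _ = \sum_i avg (fun f1 => avg (fun f2 => B i f1 f2))); last first.
  rewrite -avg_sum; apply: eq_avg => f1; rewrite -avg_sum; apply: eq_avg => f2.
  rewrite natrM !natr_card big_distrlr pair_big /=; apply: eq_bigr => -[i j] _.
  by [].
have innp : avg inn = p ^+ r by exact: avg_in_leaf.
have Bp i : i != (i0, j0) -> avg (fun f1 => avg (fun f2 => B i f1 f2)) = p ^+ (2 * r).
  case: i => [i j] ne; rewrite mul2n -addnn exprD -innp.
  (* A non-planted pair is independent even when it involves the planted [y]: this is then a shift
     by [e] of the entry at [i0], which differs from [i], and a shift keeps the law uniform. *)
  have [jj0|jj0] := eqVneq j j0.
    have ii0 : i != i0 by move: ne; rewrite jj0 xpair_eqE eqxx andbT.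
    rewrite -[X in _ = _ * X](avg_bij inn (inv_bij (bxorK (val e)))).
    rewrite -(avg_eval2 (card_bvec_gt0 d) inn _ ii0); apply: eq_avg => f1.
    rewrite -[RHS](avg_cst _ card_lists_gt0); apply: eq_avg => f2.
    rewrite /B /= ffunE jj0 eqxx /=; congr (_ * inn _).
    by apply/ffunP => b; rewrite !ffunE addbC.
  rewrite -[X in _ = X * _](avg_eval (card_bvec_gt0 d) i inn) mulrC -avgZ; apply: eq_avg => f1.
  rewrite mulrC -(avg_eval (card_bvec_gt0 d) j inn) -avgZ; apply: eq_avg => f2.
  by rewrite /B /= ffunE (negbTE jj0).
have sumB : \sum_(i | i != (i0, j0)) avg (fun f1 => avg (fun f2 => B i f1 f2))
    = (L ^ 2 - 1)%:R * p ^+ (2 * r).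
  rewrite (eq_bigr _ Bp) sumr_const -[_ *+ _]mulr_natl; congr (_%:R * _).
  by rewrite cardC1 card_prod card_ord subn1.
rewrite (bigD1 (i0, j0)) //= sumB; apply/andP; split.
  rewrite lerDr; apply: avg_ge => [|f1]; first exact: card_lists_gt0.
  by apply: avg_ge => [|f2]; [exact: card_lists_gt0|case/andP: (B01 (i0, j0) f1 f2)].
rewrite addrC lerD //.
  by rewrite ler_wpM2r ?exprn_ge0 ?pr_filter_ge0 // ler_nat leq_subr.
apply: avg_le => [|f1]; first exact: card_lists_gt0.
by apply: avg_le => [|f2]; [exact: card_lists_gt0|case/andP: (B01 (i0, j0) f1 f2)].
Qed.

Lemma avg_leaf s :
  (L ^ 2 - 1)%:R * p ^+ (2 * r)
  <= avg (fun I : instance => avg (fun rho : rep => (nodeA w I rho r s * nodeB w I rho r s)%:R : F))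
  <= (L ^ 2)%:R * p ^+ (2 * r) + 1.
Proof.
have ij0 : (0 < #|{: 'I_L * 'I_L}|)%N by rewrite card_prod card_ord muln_gt0 L0.
rewrite exchange_avg; apply/andP; split.
  apply: avg_ge => [|rho]; first exact: card_rep_gt0.
  rewrite avg_instance; apply: avg_ge => [|e]; first exact: card_err_gt0.
  by apply: avg_ge => // -[i0 j0]; have /andP[] := avg_leaf_pairs rho s i0 j0 e.
apply: avg_le => [|rho]; first exact: card_rep_gt0.
rewrite avg_instance; apply: avg_le => [|e]; first exact: card_err_gt0.
by apply: avg_le => // -[i0 j0]; have /andP[] := avg_leaf_pairs rho s i0 j0 e.
Qed.

(** Only the permutation and the filters are averaged, so the list is arbitrary; this covers [list2]
    with its correlated entry. *)
Lemma avg_list_in_node (f : {ffun 'I_L -> bvec d}) l s : (l <= r)%N ->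
  avg (fun rho : rep => #|[set i | in_node w rho l s (f i)]|%:R : F) = L%:R * p ^+ l.
Proof.
move=> lr; under eq_avg do rewrite natr_card.
rewrite avg_sum (eq_bigr (fun=> p ^+ l)).
  by rewrite sumr_const card_ord -[p ^+ l *+ L]mulr_natl.
move=> i _; rewrite avg_pair -[RHS](avg_cst _ (T := {perm 'I_d})).
  by apply: eq_avg => pi; apply: avg_in_node.
by apply/card_gt0P; exists 1%g.
Qed.

(* Everything but the pairwise comparisons at the leaves. *)
Definition scan_cost : F :=
  (d * (2 * L) + 1)%:R + \sum_(l < r) (N ^ l.+1)%:R * (1 + 2 * L%:R * p ^+ l).

(** Linearity of expectation over repetitions and nodes. Scans involve one vector at a time and are
    computed exactly; only the leaf comparisons see the planted correlation, whence two bounds. *)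
Lemma avg_total_cost P :
  P%:R * (scan_cost + (N ^ r)%:R * (d%:R * ((L ^ 2 - 1)%:R * p ^+ (2 * r))))
  <= avg (fun o : omega d L W r k N P => (total_cost w o)%:R)
  <= P%:R * (scan_cost + (N ^ r)%:R * (d%:R * ((L ^ 2)%:R * p ^+ (2 * r) + 1))).
Proof.
pose leaf s := avg (fun I : instance => avg (fun rho : rep =>
  (nodeA w I rho r s * nodeB w I rho r s)%:R : F)).
rewrite (_ : avg _ = P%:R * (scan_cost + \sum_(s : pref r N | is_node r s) d%:R * leaf s)).
  have sum_leaf (c : F) : (N ^ r)%:R * c = \sum_(s : pref r N | is_node r s) c.
    rewrite sumr_const -(card_nodes N (leqnn r)) mulr_natl; congr (_ *+ _).
    by apply: eq_card => s; rewrite inE.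
  rewrite !sum_leaf; apply/andP; split; rewrite ler_wpM2l // lerD2l ler_sum // => s _;
  by rewrite ler_wpM2l //; have /andP[] := avg_leaf s.
rewrite avg_pair.
transitivity (avg (fun I : instance => P%:R * avg (fun rho : rep => (rep_cost w I rho)%:R : F))).
  apply: eq_avg => I /=; rewrite /total_cost.
  under eq_avg do rewrite natr_sum.
  rewrite avg_sum (eq_bigr (fun=> avg (fun rho : rep => (rep_cost w I rho)%:R : F))).
    by rewrite sumr_const card_ord mulr_natl.
  by move=> t _; rewrite -(avg_eval card_rep_gt0 t).
rewrite avgZ; congr (_ * _).
transitivity (avg (fun I : instance => scan_cost + \sum_(s : pref r N | is_node r s)
   d%:R * avg (fun rho : rep => (nodeA w I rho r s * nodeB w I rho r s)%:R : F))).
  apply: eq_avg => I; under eq_avg do rewrite /rep_cost natrD natrD.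
  rewrite !avgD avg_cst ?card_rep_gt0 // /scan_cost; congr (_ + _ + _).
    under eq_avg do rewrite natr_sum.
    rewrite avg_sum; apply: eq_bigr => l _.
    under eq_avg do rewrite natr_sum.
    rewrite avg_sum (eq_bigr (fun=> 1 + 2 * L%:R * p ^+ l)) => [|s _].
      rewrite sumr_const -(card_nodes N (ltn_ord l)) -[LHS]mulr_natl; congr (_%:R * _).
      by apply: eq_card => s; rewrite inE.
    under eq_avg do rewrite !natrD.
    rewrite !avgD avg_cst ?card_rep_gt0 // /nodeA /nodeB.
    rewrite !avg_list_in_node ?(ltnW (ltn_ord l)) //; ring.
  under eq_avg do rewrite natr_sum.
  rewrite avg_sum; apply: eq_bigr => s _.
  under eq_avg do rewrite natrM.
  by rewrite avgZ.
rewrite avgD avg_cst ?card_instance_gt0 //; congr (_ + _).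
by rewrite avg_sum; apply: eq_bigr => s _; rewrite avgZ.
Qed.

End Algorithm.

(** * Comparison of the expected cost with the three terms of the maximum *)

Section CostBounds.
Variable F : realFieldType.
Variables r k N w h L : nat.
Hypotheses (r0 : (0 < r)%N) (k0 : (0 < k)%N) (hw : (h <= w)%N) (wk : (2 * w <= k)%N).
Hypothesis L0 : (0 < L)%N.
Notation d := (r * k)%N.
Local Notation p := (pr_filter F k w).
Local Notation q := (pr_filter2 F k h w).
Hypothesis Nge : d%:R / q <= N%:R.

Let q0 : 0 < q. Proof. exact: pr_filter2_gt0. Qed.
Let d1 : 1 <= d%:R :> F.
Proof. by rewrite ler1n muln_gt0 r0. Qed.
Let p0 : 0 <= p. Proof. exact: pr_filter_ge0. Qed.
Let NVq : q^-1 <= N%:R.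
Proof. by apply: le_trans Nge; rewrite ler_peMl // invr_ge0 ltW. Qed.
(** Follows from q <= p. It makes [N ^ l.+1 * p ^ l] nondecreasing in [l], so the deepest scans
    dominate. *)
Let Np : 1 <= N%:R * p.
Proof.
apply: (@le_trans _ _ (q^-1 * q)); first by rewrite mulVf ?gt_eqF.
apply: ler_pM; rewrite ?invr_ge0 ?(ltW q0) //; exact: pr_filter2_le.
Qed.
Let N1 : 1 <= N%:R :> F.
Proof. by apply: le_trans Np _; rewrite ler_piMr ?pr_filter_le1. Qed.

Let scan_cost_ge : (N ^ r)%:R * (1 + 2 * L%:R * p ^+ r.-1) <= scan_cost F r k N w L.
Proof.
have lr : (r.-1 < r)%N by rewrite prednK.
rewrite /scan_cost (bigD1 (Ordinal lr)) //= prednK // addrCA lerDl addr_ge0 //.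
apply: sumr_ge0 => l _.
by rewrite mulr_ge0 // addr_ge0 // mulr_ge0 ?exprn_ge0 // mulr_ge0.
Qed.

(** Node creation, the scans for the last level and the leaf comparisons each dominate one term. In
    the application [x] is 2^(lam d) and [L] its integer part, hence the slack factor 2. *)
Lemma avg_cost_ge P (x : F) : (0 < P)%N -> (7 < d)%N -> (1 < L)%N ->
  0 <= x -> x <= 2 * L%:R ->
  let E := avg (fun o : omega d L (2 * h * r) r k N P => (total_cost w o)%:R : F) in
  [/\ (q ^+ r)^-1 <= E, x * p ^+ r.-1 / q ^+ r <= E
    & (x * p ^+ r) ^+ 2 / q ^+ r <= E].
Proof.
move=> P0 d8 L1 x0 xL E.
have Qr : 0 <= (q ^+ r)^-1 by rewrite invr_ge0 exprn_ge0 ?(ltW q0).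
have NQ : (q ^+ r)^-1 <= (N ^ r)%:R.
  by rewrite -exprVn natrX lerXn2r ?nnegrE ?invr_ge0 ?(ltW q0).
have EP : scan_cost F r k N w L + (N ^ r)%:R * (d%:R * ((L ^ 2 - 1)%:R * p ^+ (2 * r))) <= E.
  have /andP[le _] := avg_total_cost F N r0 hw wk L0 P.
  apply: le_trans le; rewrite ler_peMl ?ler1n // addr_ge0 //.
    by apply: le_trans scan_cost_ge; rewrite mulr_ge0 // addr_ge0 // !mulr_ge0 ?exprn_ge0.
  by rewrite !mulr_ge0 ?exprn_ge0.
have leaf0 : 0 <= (N ^ r)%:R * (d%:R * ((L ^ 2 - 1)%:R * p ^+ (2 * r))).
  by rewrite !mulr_ge0 ?exprn_ge0.
have scan0 : 0 <= scan_cost F r k N w L.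
  by apply: le_trans scan_cost_ge; rewrite mulr_ge0 // addr_ge0 // !mulr_ge0 ?exprn_ge0.
have pr0 m : 0 <= p ^+ m by rewrite exprn_ge0.
split.
- apply: le_trans EP; apply: le_trans NQ _.
  apply: (@le_trans _ _ (scan_cost F r k N w L)); last by rewrite lerDl.
  by apply: le_trans scan_cost_ge; rewrite ler_peMr // lerDl mulr_ge0 // mulr_ge0.
- apply: le_trans EP; apply: (@le_trans _ _ (scan_cost F r k N w L)); last by rewrite lerDl.
  apply: le_trans scan_cost_ge; rewrite mulrC ler_pM // ?mulr_ge0 //.
  by apply: (@le_trans _ _ (2 * L%:R * p ^+ r.-1)); rewrite ?ler_wpM2r // lerDr.
- apply: le_trans EP; 
  apply: (@le_trans _ _ ((N ^ r)%:R * (d%:R * ((L ^ 2 - 1)%:R * p ^+ (2 * r)))));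
    last by rewrite lerDr.
  rewrite mulrC ler_pM // ?exprn_ge0 ?mulr_ge0 //.
  rewrite exprMn -exprM mulnC mulrA ler_wpM2r //.
  have : x ^+ 2 <= (2 * L%:R) ^+ 2 by rewrite lerXn2r ?nnegrE // mulr_ge0.
  move=> /le_trans; apply; rewrite -natrM -natrX -natrM ler_nat.
  (* As L >= 2, 4 L^2 <= 8 (L^2 - 1), and the factor [d] of each comparison pays for the 8. *)
  apply: (@leq_trans (8 * (L ^ 2 - 1))); last by rewrite leq_mul2r d8 orbT.
  have : (2 ^ 2 <= L ^ 2)%N by rewrite leq_exp2r.
  rewrite expnMn -[8%N]/(2 ^ 2 * 2)%N -mulnA leq_mul2l /=; move: (L ^ 2)%N => u u4.
  by rewrite mul2n -addnn -{1}(@subnK 1 u) ?leq_add2l ?subn_gt0 (leq_trans _ u4).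
Qed.

(** Rounding [N] up inflates q^-r by at most (d + 1)^r, so the numbers [X] of leaves, [Y] of deepest
    scans and [Z] of comparisons are each at most (d + 1)^r T. *)
Lemma avg_cost_le P (x T : F) : N%:R <= d.+1%:R / q -> L%:R <= x ->
  (q ^+ r)^-1 <= T -> x * p ^+ r.-1 / q ^+ r <= T -> (x * p ^+ r) ^+ 2 / q ^+ r <= T ->
  avg (fun o : omega d L (2 * h * r) r k N P => (total_cost w o)%:R : F)
  <= P%:R * (8 * d%:R * d.+1%:R ^+ r * T).
Proof.
move=> Nle Lx TX TY TZ.
have /andP[_ le] := avg_total_cost F N r0 hw wk L0 P; apply: le_trans le _.
rewrite ler_wpM2l //.
set D : F := d.+1%:R; set X : F := (N ^ r)%:R.
pose Y : F := X * (L%:R * p ^+ r.-1); pose Z : F := X * (L%:R ^+ 2 * p ^+ (2 * r)).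
have D0 : 0 <= D ^+ r by rewrite exprn_ge0.
have pr0 m : 0 <= p ^+ m by rewrite exprn_ge0.
have X0 : 0 <= X by [].
have Qr : 0 <= (q ^+ r)^-1 by rewrite invr_ge0 exprn_ge0 ?(ltW q0).
have NQ : X <= D ^+ r * (q ^+ r)^-1.
  by rewrite /X -exprVn natrX -exprMn lerXn2r ?nnegrE // mulr_ge0 ?invr_ge0 ?(ltW q0).
have x0 : 0 <= x by apply: le_trans Lx.
have XT : X <= D ^+ r * T by apply: le_trans NQ _; rewrite ler_wpM2l.
have YT : Y <= D ^+ r * T.
  apply: (@le_trans _ _ (D ^+ r * (q ^+ r)^-1 * (x * p ^+ r.-1))).
    by rewrite ler_pM ?mulr_ge0 // ler_wpM2r.
  by rewrite -mulrA ler_wpM2l // mulrC.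
have ZT : Z <= D ^+ r * T.
  apply: (@le_trans _ _ (D ^+ r * (q ^+ r)^-1 * (x ^+ 2 * p ^+ (2 * r)))).
    by rewrite ler_pM ?mulr_ge0 ?exprn_ge0 // ler_wpM2r // lerXn2r ?nnegrE.
  rewrite -mulrA ler_wpM2l // mulrC; apply: le_trans TZ.
  by rewrite [(x * p ^+ r) ^+ 2]exprMn -[(p ^+ r) ^+ 2]exprM [(r * 2)%N]mulnC.
have NpX l : (l < r)%N -> (N ^ l.+1)%:R * p ^+ l <= X * p ^+ r.-1 :> F.
  move=> lr; rewrite /X -{1}(prednK r0) !natrX !exprS -!mulrA -!exprMn ler_wpM2l //.
  by rewrite ler_weXn2l // -ltnS prednK.
(* Level 0 of [NpX] gives X p^(r-1) >= N >= 1, so permuting the lists is absorbed into [Y]. *)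
have LY : L%:R <= Y.
  rewrite /Y mulrCA ler_peMr //; apply: le_trans (NpX 0%N r0).
  by rewrite expr0 mulr1 expn1.
have N0 : (0 < N)%N by rewrite -(ler1n F).
have X1 : 1 <= X by rewrite ler1n expn_gt0 N0.
have scan : scan_cost F r k N w L <= 2 * d%:R * L%:R + 1 + r%:R * (X + 2 * Y).
  rewrite /scan_cost natrD !natrM mulrCA mulrA lerD2l.
  apply: (@le_trans _ _ (\sum_(l < r) (X + 2 * Y))); last first.
    by rewrite sumr_const card_ord -[leLHS]mulr_natl.
  apply: ler_sum => l _; rewrite mulrDr mulr1 lerD //.
    by rewrite ler_nat leq_pexp2l.
  rewrite -!mulrA mulrCA ler_wpM2l // mulrCA /Y [X * _]mulrCA ler_wpM2l //.
  exact: NpX.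
have rd : r%:R <= d%:R :> F by rewrite ler_nat leq_pmulr.
have Y0 : 0 <= Y by apply: le_trans LY.
have dT : 0 <= D ^+ r * T by apply: le_trans X0 XT.
(* Permuting and scanning take at most 4dY + 2dX, the leaves dZ + dX; the coefficients add up to
   8. *)
apply: (@le_trans _ _ (4 * d%:R * Y + 3 * d%:R * X + d%:R * Z)); last first.
  have -> : 8 * d%:R * D ^+ r * T = 8 * (d%:R * (D ^+ r * T)) by rewrite !mulrA.
  have := ler_wpM2l (ler0n F d) XT; have := ler_wpM2l (ler0n F d) YT.
  have := ler_wpM2l (ler0n F d) ZT; rewrite -!mulrA.
  set x1 := _ * Z; set x2 := _ * Y; set x3 := _ * X; set x4 := _ * (_ * T).
  move=> {}ZT {}YT {}XT; lra.
have -> : X * (d%:R * ((L ^ 2)%:R * p ^+ (2 * r) + 1)) = d%:R * Z + d%:R * X.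
  by rewrite /Z natrX; ring.
have : r%:R * (X + 2 * Y) <= d%:R * (X + 2 * Y) by rewrite ler_wpM2r // addr_ge0 ?mulr_ge0.
have : d%:R * L%:R <= d%:R * Y by rewrite ler_wpM2l.
have : 1 <= d%:R * X by apply: le_trans X1 _; rewrite ler_peMl.
move: scan; rewrite !mulrDr [r%:R * (2 * _)]mulrCA [d%:R * (2 * _)]mulrCA -!mulrA.
set x1 := _ * Z; set x2 := d%:R * Y; set x3 := d%:R * X; set x4 := _ * L%:R.
set x5 := r%:R * X; set x6 := r%:R * Y; set x7 := scan_cost _ _ _ _ _ _.
clearbody x1 x2 x3 x4 x5 x6 x7; lra.
Qed.

End CostBounds.

(** * Asymptotics *)

(* On Stdlib's [Rle] and [Rlt] the tactics of algebra-tactics, which shadow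
   Stdlib's, do not apply. *)
Ltac Rlra := Lra.lra.
Ltac Rnra := Psatz.nra.

Lemma IZR_natr n : IZR (Z.of_nat n) = n%:R :> R.
Proof. by rewrite -INR_IZR_INZ INRE. Qed.

Lemma pow2_natr k : (pow 2 k) = (2 ^ k)%:R :> R.
Proof. by rewrite RpowE natrX -(IZR_natr 2). Qed.

Lemma p_parE k w : p_par k w = pr_filter R k w.
Proof. by rewrite /p_par RdivE INRE pow2_natr. Qed.

Lemma q_parE k h w : q_par k h w = pr_filter2 R k h w.
Proof. by rewrite /q_par RdivE INRE pow2_natr. Qed.

Lemma PsuccE d L W r k N P w :
  Psucc d L W r k N P w = avg (fun o : omega d L W r k N P => (success w o)%:R : R).
Proof. by rewrite /Psucc RdivE !INRE avg_ind. Qed.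

Lemma EcostE d L W r k N P w :
  Ecost d L W r k N P w = avg (fun o : omega d L W r k N P => (total_cost w o)%:R : R).
Proof. by rewrite /Ecost RdivE !INRE natr_sum. Qed.

Local Open Scope R_scope.

Lemma Rle_mul_of_div (x y z : R) : 0 < z -> x / z <= y -> x <= y * z.
Proof.
move=> z0 /(Rmult_le_compat_r z _ _ (Rlt_le _ _ z0)).
by rewrite /Rdiv Rmult_assoc Rinv_l; Rlra.
Qed.

Lemma Rdiv_le_of_mul (x y z : R) : 0 < z -> x <= y * z -> x / z <= y.
Proof.
move=> z0 xyz; apply: (Rmult_le_reg_r z) => //.
by rewrite /Rdiv Rmult_assoc Rinv_l; Rlra.
Qed.

Lemma exp_homo_le (x y : R) : x <= y -> exp x <= exp y.
Proof. by case=> [xy|->]; [apply/Rlt_le/exp_increasing | exact: Rle_refl]. Qed.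

Lemma q_par_gt0 k h w : (h <= w)%N -> (2 * w <= k)%N -> 0 < q_par k h w.
Proof. by move=> hw wk; apply/RltP; rewrite q_parE; apply: pr_filter2_gt0. Qed.

Lemma q_par_le k h w : (h <= w)%N -> (2 * w <= k)%N -> q_par k h w <= p_par k w.
Proof. by move=> hw wk; apply/RleP; rewrite q_parE p_parE; apply: pr_filter2_le. Qed.

Lemma p_par_le1 k w : p_par k w <= 1.
Proof. by apply/RleP; rewrite p_parE; apply: pr_filter_le1. Qed.

Lemma leq_INR m n : (m <= n)%N -> INR m <= INR n.
Proof. by move=> mn; apply: le_INR; apply/ssrnat.leP. Qed.

Lemma INR_to_nat (z : Z) : 0 <= IZR z -> INR (Z.to_nat z) = IZR z.
Proof. by move=> /le_IZR z0; rewrite INR_IZR_INZ Znat.Z2Nat.id. Qed.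

Lemma N_par_bounds d k h w : (h <= w)%N -> (2 * w <= k)%N ->
  INR d / q_par k h w <= INR (N_par d k h w) <= INR d / q_par k h w + 1.
Proof.
move=> hw wk; have q0 := q_par_gt0 hw wk.
have x0 : 0 <= INR d / q_par k h w.
  by apply: Rmult_le_pos (pos_INR d) _; apply/Rlt_le/Rinv_0_lt_compat.
have [up1 up2] := archimed (INR d / q_par k h w).
by rewrite /N_par INR_to_nat; Rlra.
Qed.

Lemma L_par_bounds lam d : 1 <= lam * INR d ->
  2 <= INR (L_par lam d) <= Rpower 2 (lam * INR d)
  /\ Rpower 2 (lam * INR d) <= 2 * INR (L_par lam d).
Proof.
move=> ld; have x2 : 2 <= Rpower 2 (lam * INR d).
  by rewrite -{1}(Rpower_1 2); [apply: Rle_Rpower|]; Rlra.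
have [ip1 ip2] := base_Int_part (Rpower 2 (lam * INR d)).
have ip3 : 2 <= IZR (Int_part (Rpower 2 (lam * INR d))).
  apply: IZR_le; suff : Z.lt 1 (Int_part (Rpower 2 (lam * INR d))) by lia.
  by apply: lt_IZR; Rlra.
by rewrite /L_par INR_to_nat; Rlra.
Qed.

Lemma bernoulli_le t r : 0 <= t <= 1 -> 1 - INR r * t <= (1 - t) ^ r.
Proof.
move=> t01; elim: r => [|r IHr]; first by rewrite /=; Rlra.
rewrite S_INR [_ ^ r.+1]/=.
have := pos_INR r; have : 0 <= INR r * (t * t) by apply: Rmult_le_pos (pos_INR r) _; Rnra.
by Rnra.
Qed.

Lemma pow1B_le_exp x n : 0 <= 1 - x -> (1 - x) ^ n <= exp (- (INR n * x)).
Proof.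
move=> x1; have -> : exp (- (INR n * x)) = exp (- x) ^ n.
  rewrite -Rpower_pow; last exact: exp_pos.
  by rewrite /Rpower ln_exp; congr exp; Rlra.
by apply: pow_incr; split=> //; have := exp_ineq1_le (- x); Rlra.
Qed.

(** Bound exp x below by (1 + x/3)^3: 27 times its excess over x (x + 1) is x^2 (x - 18) + 27, which
    is where 18 comes from. *)
Lemma quadratic_exp_le (x : R) : 18 <= x -> (x + 1) * x * exp (- x) <= 1.
Proof.
move=> x18; have e3 : exp x = exp (x / 3) ^ 3.
  by rewrite /= Rmult_1_r -!exp_plus; congr exp; Rlra.
have e1 := exp_ineq1_le (x / 3).
have : (1 + x / 3) ^ 3 <= exp x by rewrite e3; apply: pow_incr; Rlra.
have ex0 := exp_pos x; rewrite exp_Ropp => le.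
apply: (Rmult_le_reg_r (exp x)) => //; rewrite Rmult_assoc Rinv_l; last Rlra.
rewrite /= in le; Rnra.
Qed.

Lemma failure_le_exp r k N w h L : (0 < r)%N -> (h <= w)%N -> (2 * w <= k)%N ->
  (0 < L)%N -> INR (r * k) / q_par k h w <= INR N -> 18 <= INR (r * k) ->
  1 - Psucc (r * k) L (2 * h * r) r k N (P_par (r * k) r) w <= exp (- INR (r * k)).
Proof.
move=> r0 hw wk L0 Nge d18; set d := (r * k)%N in Nge d18 *.
have q0 := q_par_gt0 hw wk.
have q1 : q_par k h w <= 1 by have := q_par_le hw wk; have := p_par_le1 k w; Rlra.
pose t := (1 - q_par k h w) ^ N.
pose K := INR (k.+1 ^ r).
have fail : 1 - Psucc d L (2 * h * r) r k N (P_par d r) w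
    <= (1 - (1 - t) ^ r / K) ^ P_par d r.
  apply/RleP; rewrite PsuccE /t /K !RpowE RdivE INRE q_parE.
  exact: pr_failure_le.
have t01 : 0 <= t <= 1.
  by split; [apply: pow_le; Rlra | rewrite -[X in _ <= X](pow1 N); apply: pow_incr; Rlra].
have te : t <= exp (- INR d).
  apply: Rle_trans (pow1B_le_exp N _) _; first Rlra.
  exact/exp_homo_le/Ropp_le_contravar/Rle_mul_of_div.
have K1 : 1 <= K by rewrite -[1]/(INR 1); apply: leq_INR; rewrite expn_gt0.
have K0 : 0 < K by Rlra.
have s01 : 0 <= (1 - t) ^ r <= 1.
    by split; [apply: pow_le; Rlra | rewrite -[X in _ <= X](pow1 r); apply: pow_incr; Rlra].
have b1 : (1 - t) ^ r / K <= 1.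
  by apply: Rdiv_le_of_mul; Rlra.
apply: Rle_trans fail _; apply: Rle_trans (pow1B_le_exp _ _) _; first Rlra.
apply/exp_homo_le/Ropp_le_contravar.
(* Since k <= d, [r] of the [r + 1] factors of [P_par] pay for [K], and one factor d + 1 is left
   over. *)
have PK : (INR d + 1) * K <= INR (P_par d r).
  rewrite -S_INR /K -mult_INR; apply: leq_INR; rewrite multE /P_par expnS.
  by rewrite leq_mul2l /= leq_exp2r // ltnS leq_pmull.
have s_ge := bernoulli_le r t01.
have rd : INR r <= INR d.
  apply: leq_INR; rewrite leq_pmulr //; move: d18; rewrite /d.
  by case: (k) => //; rewrite muln0 /=; Rlra.
(* This gives (d + 1)(1 - d e^-d) >= d, the exponent required. *)
have quad := quadratic_exp_le d18.
have rt : INR r * t <= INR d * exp (- INR d).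
  by apply: Rmult_le_compat => //; [exact: pos_INR | Rlra].
have : (INR d + 1) * (1 - t) ^ r <= INR (P_par d r) * ((1 - t) ^ r / K).
  have -> : (INR d + 1) * (1 - t) ^ r = ((INR d + 1) * K) * ((1 - t) ^ r / K).
    transitivity ((INR d + 1) * (1 - t) ^ r * (K * / K)); last by rewrite /Rdiv; Rlra.
    by rewrite Rinv_r; Rlra.
  apply: Rmult_le_compat_r PK; apply: Rmult_le_pos; first Rlra.
  exact/Rlt_le/Rinv_0_lt_compat.
Rnra.
Qed.

(** With 8 <= (n + 1)^3 the exponents of n + 1 total 2r + 5 <= 7r, and n + 1 <= n^2 doubles this to
    14r. *)
Lemma poly_factor_le (n r : nat) : (1 < n)%N -> (0 < r)%N ->
  (n.+1 ^ r.+1 * (8 * n * n.+1 ^ r) <= n ^ (14 * r))%N.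
Proof.
move=> n1 r0; apply: (@leq_trans (n.+1 ^ (7 * r))); last first.
  rewrite (_ : 14 * r = 2 * (7 * r))%N; last by rewrite mulnA.
  rewrite [(n ^ _)%N]expnM leq_exp2r.
    by rewrite expnS expn1; nia.
  by rewrite muln_gt0.
apply: (@leq_trans (n.+1 ^ (r.+1 + (3 + 1 + r)))); last by rewrite leq_pexp2l; lia.
rewrite !expnD expn1 leq_mul // leq_mul // leq_mul //.
by apply: (@leq_trans (3 ^ 3)%N); rewrite // leq_exp2r.
Qed.

(** * The cost bounds for the actual parameters over the reals *)

Section CostOnReals.
Variables (lam : R) (r k h w : nat).
Hypotheses (r0 : (0 < r)%N) (hw : (h <= w)%N) (wk : (2 * w <= k)%N).
Notation d := (r * k)%N.
Hypotheses (d18 : (18 <= d)%N) (lamd : 1 <= lam * INR d).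
Let x := Rpower 2 (lam * INR d).
Let L := L_par lam d.
Let N := N_par d k h w.
Let T := T_par lam d r k h w.
Let E := Ecost d L (2 * h * r) r k N (P_par d r) w.

Let k0 : (0 < k)%N.
Proof. by move: d18; case: (k) => //; rewrite muln0. Qed.

Let L2 : (1 < L)%N.
Proof. by have [[L2 _] _] := L_par_bounds lamd; apply/ssrnat.leP/INR_le. Qed.

Let Nge : (d%:R / pr_filter2 R k h w <= N%:R)%R.
Proof.
by apply/RleP; rewrite -!INRE -q_parE; have [] := N_par_bounds d hw wk.
Qed.

Let T_parE : T = Rmax (Rmax ((pr_filter2 R k h w ^+ r)^-1)%R
  (x * pr_filter R k w ^+ r.-1 / pr_filter2 R k h w ^+ r)%R)
  ((x * pr_filter R k w ^+ r) ^+ 2 / pr_filter2 R k h w ^+ r)%R.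
Proof. by rewrite /T /T_par -subn1 !RpowE !RdivE q_parE p_parE. Qed.

Lemma T_par_le_Ecost : T <= E.
Proof.
have [[_ Lx] xL] := L_par_bounds lamd.
have P0 : (0 < P_par d r)%N by rewrite expn_gt0.
have x0 : (0 <= x)%R by apply/RleP/Rlt_le/exp_pos.
have xL' : (x <= 2 * L%:R)%R.
  by rewrite -[2%:R%R]/(2%:R : R)%R -(IZR_natr 2) -INRE; apply/RleP.
have d7 : (7 < d)%N by apply: leq_trans d18.
have [e1 e2 e3] := avg_cost_ge r0 k0 hw wk (ltnW L2) Nge P0 d7 L2 x0 xL'.
rewrite T_parE /E EcostE.
by apply: Rmax_lub; [apply: Rmax_lub|]; apply/RleP.
Qed.

(** From q <= p <= 1 comes q^r <= p^(r-1), so the middle term alone reaches 2^(lam d). This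
    exponential size is what absorbs the factor d^(14r). *)
Lemma Rpower_le_T_par : x <= T.
Proof.
have q0 := q_par_gt0 hw wk; have qp := q_par_le hw wk; have p1 := p_par_le1 k w.
have x0 : 0 < x by apply: exp_pos.
apply: (Rle_trans _ (x * p_par k w ^ (r - 1) / q_par k h w ^ r)); last first.
  by apply: Rle_trans (Rmax_l _ _); apply: Rmax_r.
rewrite /Rdiv Rmult_assoc -{1}[x]Rmult_1_r.
apply: Rmult_le_compat_l; first exact: Rlt_le.
have qr0 : 0 < q_par k h w ^ r by apply: pow_lt.
apply: (Rmult_le_reg_r (q_par k h w ^ r)) => //.
rewrite Rmult_assoc Rinv_l ?Rmult_1_l ?Rmult_1_r; last by apply/Rgt_not_eq.
rewrite -{1}(prednK r0) subn1 [_ ^ r.-1.+1]/= -[X in _ <= X]Rmult_1_l.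
apply: Rmult_le_compat; [exact: Rlt_le|exact/Rlt_le/pow_lt|Rlra|].
by apply: pow_incr; Rlra.
Qed.

Lemma Ecost_le_T_par : E <= INR d ^ (14 * r) * T.
Proof.
have [[_ Lx] _] := L_par_bounds lamd.
have q0 := q_par_gt0 hw wk.
have q1 : q_par k h w <= 1 by have := q_par_le hw wk; have := p_par_le1 k w; Rlra.
have Lx' : (L%:R <= x)%R by apply/RleP; rewrite -INRE.
have Nle : (N%:R <= d.+1%:R / pr_filter2 R k h w)%R.
  apply/RleP; rewrite -!INRE -q_parE S_INR -RdivE.
  have [_ up] := N_par_bounds d hw wk; apply: Rle_trans up _.
  rewrite /Rdiv Rmult_plus_distr_r Rmult_1_l; apply: Rplus_le_compat_l.
  by rewrite -{1}Rinv_1; apply: Rinv_le_contravar.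
have [t1 t2 t3] : [/\ ((pr_filter2 R k h w ^+ r)^-1 <= T)%R,
  (x * pr_filter R k w ^+ r.-1 / pr_filter2 R k h w ^+ r <= T)%R &
  ((x * pr_filter R k w ^+ r) ^+ 2 / pr_filter2 R k h w ^+ r <= T)%R].
  split; apply/RleP; rewrite T_parE; last exact: Rmax_r.
  - by apply: Rle_trans (Rmax_l _ _); apply: Rmax_l.
  - by apply: Rle_trans (Rmax_l _ _); apply: Rmax_r.
have le := avg_cost_le r0 k0 hw wk (ltnW L2) Nge (P_par d r) Nle Lx' t1 t2 t3.
have T0 : 0 <= T by apply: Rle_trans Rpower_le_T_par; apply/Rlt_le/exp_pos.
apply: (Rle_trans _ (INR (P_par d r * (8 * d * d.+1 ^ r)) * T)).
  by apply/RleP; rewrite /E EcostE INRE RmultE natrM -mulrA natrM (natrM _ 8) natrX.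
apply: Rmult_le_compat_r => //; rewrite RpowE [INR d]INRE -natrX -INRE.
apply: leq_INR; apply: poly_factor_le => //; exact: leq_trans d18.
Qed.

End CostOnReals.

Lemma ln_le (y z : R) : 0 < y -> y <= z -> ln y <= ln z.
Proof. by move=> y0 [yz|->]; [apply/Rlt_le/ln_increasing | exact: Rle_refl]. Qed.

Lemma ln_le_sub (A : R) : exists M, forall y, M <= y -> A * ln y <= y.
Proof.
(* The bound ln y <= 2 sqrt y reduces the claim to 2A <= sqrt y; y >= 1 keeps ln y nonnegative, so
   negative [A] is covered. *)
exists (Rmax 1 (4 * A ^ 2)) => y My.
have y1 : 1 <= y by apply: Rle_trans My; apply: Rmax_l.
have yA : 4 * A ^ 2 <= y by apply: Rle_trans My; apply: Rmax_r.
have s0 : 0 < sqrt y by apply: sqrt_lt_R0; Rlra.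
have ss : sqrt y * sqrt y = y by apply: sqrt_sqrt; Rlra.
have lny : 0 <= ln y <= 2 * sqrt y.
  split; first by rewrite -ln_1; apply: ln_le; Rlra.
  rewrite -{1}ss ln_mult //.
  have : ln (sqrt y) <= sqrt y.
    rewrite -[X in _ <= X]ln_exp; apply: ln_le => //.
    by have := exp_ineq1_le (sqrt y); Rlra.
  by Rlra.
have : 2 * A <= sqrt y by rewrite /= in yA; Rnra.
by Rnra.
Qed.

Theorem theorem2
  (gam lam del : R)
  (Hgam : (0 <= gam <= 1/2)) (Hlam : (0 < lam <= 1))
  (Hdel : (gam / 2 <= del <= 1/2))
  (* a sequence of dimensions d n -> oo, with integer parameters
     r n ~ lam d / log^2 d, k n = d / r, 2 h n ~ gam k, w n ~ del k *)
  (d r k h w : nat -> nat)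
  (Hd : forall M : nat, exists n0, forall n, (n0 <= n)%N -> (M <= d n)%N)
  (Hrk : forall n, (0 < r n)%N /\ (r n * k n)%N = d n)
  (Hhw : forall n, (h n <= w n)%N /\ (2 * w n <= k n)%N)
  (Hr : forall eps : R, (0 < eps) -> exists n0, forall n, (n0 <= n)%N ->
          (Rabs (INR (r n) * log2 (INR (d n)) ^ 2 / (lam * INR (d n)) - 1) <= eps))
  (Hh : forall eps : R, (0 < eps) -> exists n0, forall n, (n0 <= n)%N ->
          (Rabs (2 * INR (h n) / INR (k n) - gam) <= eps))
  (Hw : forall eps : R, (0 < eps) -> exists n0, forall n, (n0 <= n)%N ->
          (Rabs (INR (w n) / INR (k n) - del) <= eps)) :
  let L n := L_par lam (d n) in
  let W n := (2 * h n * r n)%N in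
  let N n := N_par (d n) (k n) (h n) (w n) in
  let P n := P_par (d n) (r n) in
  let Ps n := Psucc (d n) (L n) (W n) (r n) (k n) (N n) (P n) (w n) in
  let E n := Ecost (d n) (L n) (W n) (r n) (k n) (N n) (P n) (w n) in
  let T n := T_par lam (d n) (r n) (k n) (h n) (w n) in
  (* success probability overwhelming in d *)
  (forall c : R, (0 < c) -> exists n0, forall n, (n0 <= n)%N ->
      (1 - Ps n <= Rpower (INR (d n)) (- c))) /\
  (* in fact at least 1 - d e^-d for large d *)
  (exists n0, forall n, (n0 <= n)%N ->
      (1 - Ps n <= INR (d n) * exp (- INR (d n)))) /\
  (* expected running time T^(1 + o(1)) *)
  (forall eps : R, (0 < eps) -> exists n0, forall n, (n0 <= n)%N ->
      (Rpower (T n) (1 - eps) <= E n <= Rpower (T n) (1 + eps))).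
Proof.
move=> L W N P Ps E T.
have Hd_real (M : R) : exists n0, forall n, (n0 <= n)%N -> M <= INR (d n).
  have [m Mm] := INR_archimed 1 M Rlt_0_1; have [n0 n0P] := Hd m.
  by exists n0 => n /n0P/leq_INR; Rlra.
(* 18 serves the quadratic estimate; 1 / lam makes lam d >= 1, so that the lists have at least two
   entries. *)
pose M0 := Rmax 18 (/ lam).
have M0P n : M0 <= INR (d n) ->
    [/\ 18 <= INR (d n), (18 <= d n)%N & 1 <= lam * INR (d n)].
  move=> Mn; have d18 : 18 <= INR (d n) by apply: Rle_trans Mn; apply: Rmax_l.
  split=> //.
    by apply/ssrnat.leP/INR_le; rewrite [INR 18]INR_IZR_INZ.
  have : / lam <= INR (d n) by apply: Rle_trans Mn; apply: Rmax_r.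
  move=> /(Rmult_le_compat_l lam _ _ (Rlt_le _ _ (proj1 Hlam))).
  by rewrite Rinv_r; Rlra.
have fail n : M0 <= INR (d n) -> 1 - Ps n <= exp (- INR (d n)).
  move=> /M0P[d18 d18' ld]; rewrite /Ps /W /P /N /L.
  have [hw wk] := Hhw n; have [r0 rk] := Hrk n.
  rewrite -rk in d18 d18' ld *; apply: failure_le_exp => //.
    have [[L2 _] _] := L_par_bounds ld; apply/ssrnat.leP/INR_lt.
    by rewrite [INR 0]/=; Rlra.
  by have [] := N_par_bounds (r n * k n) hw wk.
split; [|split].
- move=> c c0; have [M MP] := ln_le_sub c.
  have [n0 n0P] := Hd_real (Rmax M0 M); exists n0 => n /n0P dn.
  have dM0 : M0 <= INR (d n) by apply: Rle_trans dn; apply: Rmax_l.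
  apply: Rle_trans (fail n dM0) _; rewrite /Rpower.
  rewrite Ropp_mult_distr_l_reverse; apply/exp_homo_le/Ropp_le_contravar.
  by apply: MP; apply: Rle_trans dn; apply: Rmax_r.
- have [n0 n0P] := Hd_real M0; exists n0 => n /n0P dM0.
  apply: Rle_trans (fail n dM0) _; have [d18 _ _] := M0P n dM0.
  have := exp_pos (- INR (d n)); Rnra.
move=> eps eps0.
(* Accuracy 1 already yields r log^2 d <= 2 lam d. Then 14 r log d <= 28 lam d / log d, which
   explains the threshold exp(28 / eps) below. *)
have [n1 n1P] := Hr 1 Rlt_0_1.
have [n2 n2P] := Hd_real (Rmax M0 (exp (28 / eps))).
exists (maxn n1 n2) => n; rewrite geq_max => /andP[/n1P rn /n2P dn].
have dM0 : M0 <= INR (d n) by apply: Rle_trans dn; apply: Rmax_l.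
have lnd : 28 / eps <= ln (INR (d n)).
  rewrite -[X in X <= _]ln_exp; apply: ln_le; first exact: exp_pos.
  by apply: Rle_trans dn; apply: Rmax_r.
have [d18 d18' ld] := M0P n dM0.
have [hw wk] := Hhw n; have [r0 rk] := Hrk n.
rewrite -rk in d18' ld.
have TE := T_par_le_Ecost r0 hw wk d18' ld.
have xT := Rpower_le_T_par lam r0 hw wk.
have ET := Ecost_le_T_par r0 hw wk d18' ld.
rewrite rk -/(L n) -/(N n) -/(P n) -/(T n) -/(W n) -/(E n) in TE xT ET.
rewrite rk in ld; have [x2 _] := L_par_bounds ld.
set x := Rpower 2 _ in x2 xT.
(* Powers of T therefore grow with the exponent, and T <= E settles the lower bound. *)
have T1 : 1 <= T n by Rlra.
split.
  apply: Rle_trans TE; rewrite -[X in _ <= X]Rpower_1; last by Rlra.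
  by apply: Rle_Rpower; Rlra.
apply: Rle_trans ET _; rewrite Rpower_plus Rpower_1; last by Rlra.
rewrite [X in _ <= X]Rmult_comm; apply: Rmult_le_compat_r; first by Rlra.
(* As T >= x, it remains to compare d^(14r) with x^eps, which is done on exponents. *)
apply: (Rle_trans _ (Rpower x eps)); last by apply: Rle_Rpower_l; Rlra.
rewrite /x Rpower_mult -Rpower_pow; last by Rlra.
rewrite /Rpower mult_INR.
set g := log2 (INR (d n)) in rn.
have ln2 : 0 < ln 2 <= 1.
  split; first by have := ln_lt_2; Rlra.
  by rewrite -[X in _ <= X]ln_exp; apply: ln_le; have := exp_ineq1_le 1; Rlra.
have lnE : ln (INR (d n)) = g * ln 2.
  by rewrite /g /log2 /Rdiv Rmult_assoc Rinv_l; Rlra.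
have q28 : 0 < 28 / eps by apply: Rdiv_lt_0_compat; Rlra.
have g0 : 0 < g by apply: (Rmult_lt_reg_r (ln 2)); Rlra.
have g28 : 28 <= g * eps.
  apply: Rle_mul_of_div => //; apply: Rle_trans lnd _; rewrite lnE.
  by rewrite -[X in _ <= X]Rmult_1_r; apply: Rmult_le_compat_l; Rlra.
have rg : INR (r n) * g ^ 2 <= 2 * (lam * INR (d n)).
  apply: Rle_mul_of_div; first by Rlra.
  by have := Rle_abs (INR (r n) * g ^ 2 / (lam * INR (d n)) - 1); Rlra.
apply: exp_homo_le; rewrite lnE (_ : INR 14 = 14); last by rewrite /=; Rlra.
(* Multiplying g eps >= 28 by r g gives 28 r g <= r g^2 eps <= 2 lam d eps. *)
suff : 14 * (INR (r n) * g) <= lam * INR (d n) * eps.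
  by move=> /(Rmult_le_compat_r _ _ _ (Rlt_le _ _ (proj1 ln2))); Rlra.
have rg0 : 0 <= INR (r n) * g by apply: Rmult_le_pos (pos_INR _) _; Rlra.
have := Rmult_le_compat_l _ _ _ rg0 g28.
have := Rmult_le_compat_r eps _ _ (Rlt_le _ _ eps0) rg.
by rewrite /=; Rlra.
Qed.
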